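(* Let $G$ be a finite group, let $N$ be a normal subgroup of $G$, and let $\varphi$ be a self-dual irreducible $2$-Brauer character of $N$. Then: (i) $\varphi$ extends to its stabilizer in $G$ (i.e. there is a $2$-Brauer character of the stabilizer of $\varphi$ in $G$ whose restriction to $N$ is $\varphi$), and exactly one of these extensions is self-dual. (ii) $G$ has a unique self-dual irreducible $2$-Brauer character $\theta$ such that $\varphi$ occurs with odd multiplicity in $\theta{\downarrow_N}$. (iii) For this $\theta$, $\varphi$ occurs with multiplicity $1$ in $\theta{\downarrow_N}$.
   Context: Fix a $2$-modular system $(K,R,F)$: $R$ is a complete discrete valuation ring with field of fractions $K$ of characteristic $0$ and residue field $F=R/J(R)$ of characteristic $2$; $K$ and $F$ are assumed to be splitting fields for all subgroups of $G$. The Brauer character of an $FG$-module is an $R$-valued class function on the $2$-regular (odd order) elements of $G$; the irreducible $2$-Brauer characters of $G$ are the Brauer characters of the irreducible $FG$-modules. The dual $\overline{\theta}$ of a Brauer character $\theta$ is $\overline{\theta}(g)=\theta(g^{-1})$, and $\theta$ is self-dual if $\theta=\overline{\theta}$. $\theta{\downarrow_N}$ denotes restriction to $N$. $G$ acts by conjugation on the irreducible Brauer characters of its normal subgroup $N$. *)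

(* Defs.v *)
From HB Require Import structures.
From mathcomp Require Import all_boot all_order all_algebra.
From mathcomp Require Import all_fingroup all_solvable all_field all_character.

Set Implicit Arguments.
Unset Strict Implicit.
Unset Printing Implicit Defensive.

Import GroupScope GRing.Theory.
Local Open Scope ring_scope.

Definition rdvd (R : idomainType) (a b : R) : Prop := exists c : R, b = c * a.

Definition uniformizer (R : idomainType) (pi : R) : Prop :=
  [/\ pi != 0, pi \isn't a GRing.unit
    & forall a : R, a != 0 ->
        exists n : nat, exists2 u : R, u \is a GRing.unit & a = u * pi ^+ n].

Definition adic_cauchy (R : idomainType) (pi : R) (a : nat -> R) : Prop :=
  forall n : nat, exists M : nat, forall i j : nat,
    (M <= i)%N -> (M <= j)%N -> rdvd (pi ^+ n) (a i - a j).

Definition adic_cvg (R : idomainType) (pi : R) (a : nat -> R) (l : R) : Prop :=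
  forall n : nat, exists M : nat, forall i : nat,
    (M <= i)%N -> rdvd (pi ^+ n) (a i - l).

Definition complete_dvr (R : idomainType) : Prop :=
  exists pi : R, uniformizer pi /\
    forall a : nat -> R, adic_cauchy pi a -> exists l : R, adic_cvg pi a l.

(* The p-modular system (K, R, F) has K = {fraction R}; the residue field      *)
(* R / J(R) is presented by a surjection red : R -> F whose kernel is J(R),    *)
(* which is the set of nonunits because R is local.                           *)
Record modular_system (p : nat) (R : idomainType) (F : fieldType)
    (red : {rmorphism R -> F}) : Prop := ModularSystem {
  modsys_dvr : complete_dvr R;
  modsys_surj : forall x : F, exists a : R, red a = x;
  modsys_ker : forall a : R, red a = 0 <-> a \isn't a GRing.unit;
  modsys_pchar0 : [pchar {fraction R}] =i pred0;
  modsys_pchar : p \in [pchar F]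
}.

Definition splits_subgroups (K : fieldType) (gT : finGroupType)
    (G : {group gT}) : Prop :=
  forall H : {group gT}, H \subset G -> group_splitting_field K H.

Section BrauerCharacters.

Variables (p : nat) (R : idomainType) (F : fieldType).
Variables (red : {rmorphism R -> F}) (gT : finGroupType).

(* A function on the p-regular elements of a group G is encoded as a function  *)
(* on gT that vanishes at all other elements. At a p-regular g, the eigenvalues *)
(* of g (with multiplicity) are lifted through red to #[g]-th roots of unity   *)
(* in R, and these lifts are added up; since p does not divide #[g], red is    *)
(* injective on such roots of unity, so the value is uniquely determined.      *)
Definition brauer_char_of (G : {group gT}) (n : nat)
    (rG : mx_representation F G n) (theta : {ffun gT -> R}) : Prop :=
  forall g : gT,
    if (g \in G) && p^'.-elt g then
      exists s : seq R,
        [/\ forall z : R, z \in s -> z ^+ #[g] = 1,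
            char_poly (rG g) = \prod_(z <- s) ('X - (red z)%:P)
          & theta g = \sum_(z <- s) z]
    else theta g = 0.

Definition brauer_char (G : {group gT}) (theta : {ffun gT -> R}) : Prop :=
  exists (n : nat) (rG : mx_representation F G n), brauer_char_of rG theta.

Definition irr_brauer_char (G : {group gT}) (theta : {ffun gT -> R}) : Prop :=
  exists (n : nat) (rG : mx_representation F G n),
    mx_irreducible rG /\ brauer_char_of rG theta.

Definition dual_char (theta : {ffun gT -> R}) : {ffun gT -> R} :=
  [ffun g => theta g^-1%g].

Definition self_dual (theta : {ffun gT -> R}) : Prop := theta = dual_char theta.

Definition res_char (N : {group gT}) (theta : {ffun gT -> R}) :
    {ffun gT -> R} :=
  [ffun g => if g \in N then theta g else 0].

Definition conj_char (theta : {ffun gT -> R}) (x : gT) : {ffun gT -> R} :=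
  [ffun g => theta (g ^ x^-1)%g].

Definition char_stab (G : {group gT}) (theta : {ffun gT -> R}) : {set gT} :=
  [set x in G | conj_char theta x == theta].

Lemma char_stab_group_set (G : {group gT}) (theta : {ffun gT -> R}) :
  group_set (char_stab G theta).
Proof.
apply/group_setP; split=> [|x y].
  by rewrite inE group1; apply/eqP/ffunP=> g; rewrite ffunE invg1 conjg1.
rewrite !inE => /andP[Gx /eqP sx] /andP[Gy /eqP sy]; rewrite groupM //=.
apply/eqP/ffunP=> g; rewrite ffunE invMg conjgM.
by rewrite -{2}sy ffunE -{2}sx ffunE.
Qed.
Canonical char_stab_group (G : {group gT}) (theta : {ffun gT -> R}) :=
  Group (char_stab_group_set G theta).

(* psi occurs with multiplicity m in the Brauer character theta of N: theta is *)
(* a sum of irreducible Brauer characters of N, m of which are psi. By the     *)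
(* linear independence of the irreducible Brauer characters, the terms of such *)
(* a sum, and hence m, are determined by theta.                               *)
Definition multiplicity (N : {group gT}) (psi theta : {ffun gT -> R})
    (m : nat) : Prop :=
  exists s : seq {ffun gT -> R},
    [/\ forall chi : {ffun gT -> R}, chi \in s -> irr_brauer_char N chi,
        theta = \sum_(chi <- s) chi
      & count_mem psi s = m].

End BrauerCharacters.

(* Main.v *)
(* Let M afford phi, with stabilizer T. Self-duality gives M a nondegenerate   *)
(* N-invariant bilinear form B, unique up to scalars and therefore symmetric. *)
(* Each t in T acts on M by an operator intertwining M with its t-conjugate,  *)
(* unique up to scalars, which multiplies B by some c. Here c is a square,    *)
(* because M is isomorphic to a Frobenius twist of itself; as square roots    *)
(* are unique in characteristic 2, exactly one multiple of the operator is an *)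
(* isometry of B. These isometries form the self-dual extension of M to T.    *)
(*                                                                            *)
(* Let V be an irreducible self-dual G-module over phi with odd multiplicity  *)
(* and let C be its invariant form. If some copy of M in V were isotropic for *)
(* C, so would be its G-conjugates, and a Clifford decomposition built from   *)
(* them would make the Gram matrix of the copies of M alternating and         *)
(* nondegenerate, of odd size: impossible. So no f <> 0 in Hom_N(M, V) is     *)
(* isotropic; but in characteristic 2 the difference of f and its image under *)
(* t in T is isotropic, so f is T-equivariant. The image of f is then the     *)
(* whole phi-component of V, which gives multiplicity 1, and V is determined  *)
(* by the T-module M.                                                         *)

(* The module argument transfers to Brauer characters through the group algebra. Dissimilar
   absolutely irreducible modules are separated by an element acting as 1 on one and 0 on the other
   ([not_rsim_separate]). Hence traces, and so Brauer characters, determine irreducible modules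
   ([brauer_of_rsim]), and multiplicities in a sum of irreducible Brauer characters are determined
   modulo 2 ([count_irr_brauer]).

   Part (i) is [self_dual_extension_exists] and [self_dual_extension_uniq]; its crux is that the
   multiplier of a twisting operator is a square ([twist_hom_multiplier_square]).

   Parts (ii) and (iii) concern the irreducible [V] that receive a nonzero [T]-map from the extended
   module. Every self-dual [V] of odd multiplicity does so ([odd_multiplicity_stab_hom], which rests
   on [isotropic_even]). Conversely such a [V] exists ([stab_hom_exists]), is unique
   ([stab_hom_rsim]), is self-dual ([stab_hom_self_dual]) and contains [phi] exactly once
   ([stab_hom_multiplicity]). *)
Require Import Defs.
From HB Require Import structures.
From mathcomp Require Import all_boot all_order all_algebra.
From mathcomp Require Import all_fingroup all_solvable all_field all_character.
From Stdlib Require Import Classical.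
From Stdlib Require List.

Set Implicit Arguments.
Unset Strict Implicit.
Unset Printing Implicit Defensive.

Import GroupScope GRing.Theory.
Local Open Scope ring_scope.

(** * Separation of irreducible representations *)

Section GroupAlgebra.

Variables (F : fieldType) (gT : finGroupType) (G : {group gT}).
Local Notation reprG := (mx_representation F G).

(** A function [c] stands for an element of the group algebra, its values outside [G] being
    ignored. *)
Definition repr_lin n (rG : reprG n) (c : gT -> F) : 'M_n :=
  \sum_(g in G) c g *: rG g.

Definition convolution (a b : gT -> F) (g : gT) : F :=
  \sum_(h in G) a h * b (h^-1 * g)%g.

Lemma repr_linM n (rG : reprG n) a b :
  repr_lin rG (convolution a b) = repr_lin rG a *m repr_lin rG b.
Proof.
rewrite /repr_lin mulmx_suml.
under eq_bigr => g Gg do rewrite scaler_suml.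
rewrite exchange_big /=; apply: eq_bigr => h Gh.
rewrite mulmx_sumr (reindex_inj (mulgI h)) /=.
apply: eq_big => [g | g]; first by rewrite groupMl.
rewrite groupMl // => Gg.
by rewrite mulKg repr_mxM // -scalemxAl -scalemxAr scalerA.
Qed.

Lemma repr_lin1 n (rG : reprG n) :
  repr_lin rG (fun g => (g == 1%g)%:R) = 1%:M.
Proof.
rewrite /repr_lin (bigD1 1%g) //= eqxx scale1r repr_mx1 big1 ?addr0 // => g.
by case/andP=> _ /negPf->; rewrite scale0r.
Qed.

Lemma repr_lin_sub n (rG : reprG n) a b :
  repr_lin rG (fun g => a g - b g) = repr_lin rG a - repr_lin rG b.
Proof. by rewrite -sumrB; apply: eq_bigr => g _; rewrite scalerBl. Qed.

Lemma repr_lin_sum n (rG : reprG n) (I : finType) (P : pred I) (c : I -> gT -> F) :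
  repr_lin rG (fun g => \sum_(i | P i) c i g) = \sum_(i | P i) repr_lin rG (c i).
Proof.
by rewrite /repr_lin exchange_big; apply: eq_bigr => g _; rewrite scaler_suml.
Qed.

Lemma repr_lin_scale n (rG : reprG n) a c :
  repr_lin rG (fun g => a * c g) = a *: repr_lin rG c.
Proof.
by rewrite /repr_lin scaler_sumr; apply: eq_bigr => g _; rewrite scalerA.
Qed.

Lemma repr_lin_hom n1 n2 (r1 : reprG n1) (r2 : reprG n2) (H : 'M_(n1, n2)) c :
    {in G, forall g, r1 g *m H = H *m r2 g} ->
  repr_lin r1 c *m H = H *m repr_lin r2 c.
Proof.
move=> homH; rewrite mulmx_suml mulmx_sumr; apply: eq_bigr => g Gg.
by rewrite -scalemxAl homH // scalemxAr.
Qed.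

Lemma mxtrace_repr_lin n (rG : reprG n) c :
  \tr (repr_lin rG c) = \sum_(g in G) c g * \tr (rG g).
Proof. by rewrite linear_sum /=; apply: eq_bigr => g _; rewrite mxtraceZ. Qed.

Lemma abs_irr_repr_lin n (rG : reprG n) :
  mx_absolutely_irreducible rG -> forall A, exists c, repr_lin rG c = A.
Proof.
case/andP=> _ full A; have /envelop_mxP[c ->]: (A \in enveloping_algebra_mx rG)%MS.
  exact: submx_full.
by exists c.
Qed.

Lemma irr_hom_rsim n1 n2 (r1 : reprG n1) (r2 : reprG n2) (H : 'M_(n1, n2)) :
    mx_irreducible r1 -> mx_irreducible r2 ->
    {in G, forall g, r1 g *m H = H *m r2 g} -> H != 0 ->
  mx_rsim r1 r2.
Proof.
move=> /mx_irrP[_ irr1] /mx_irrP[_ irr2] homH nzH.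
have freeH: row_free H.
  rewrite -kermx_eq0; apply: contraR nzH => nzK.
  have: row_full (kermx H).
    apply: irr1 nzK; apply/mxmoduleP=> g Gg; apply/sub_kermxP.
    by rewrite -mulmxA homH // mulmxA mulmx_ker mul0mx.
  case/row_fullP=> L LK; rewrite -[H]mul1mx -LK -mulmxA.
  by rewrite mulmx_ker mulmx0.
have fullH: row_full H.
  have: row_full <<H>>%MS.
    apply: irr2; last by rewrite -submx0 genmxE submx0.
    apply/mxmoduleP=> g Gg; rewrite genmxE (eqmxMr _ (genmxE H)).
    by rewrite -homH // submxMl.
  by rewrite /row_full genmxE.
have eq_n: n1 = n2 by rewrite -(eqP fullH) (eqP freeH).
by exists H.
Qed.

(* If [r2] annihilated no more than [r1] does, [r2 c |-> r1 c] would be a      *)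
(* well-defined morphism of matrix algebras, and a nonzero row [u] fixed by    *)
(* the image of E_00 would give an intertwiner sending e_i to [u] times the    *)
(* image of E_0i.                                                             *)
Lemma not_rsim_annihilator n1 n2 (r1 : reprG n1) (r2 : reprG n2) :
    mx_absolutely_irreducible r1 -> mx_absolutely_irreducible r2 ->
    ~ mx_rsim r1 r2 ->
  exists c, repr_lin r2 c = 0 /\ repr_lin r1 c != 0.
Proof.
move=> abs1 abs2 nsim; apply: NNPP => no_c.
have ann c: repr_lin r2 c = 0 -> repr_lin r1 c = 0.
  move=> c0; apply/eqP/negPn/negP=> nzc; apply: no_c; by exists c.
have ann2 a b: repr_lin r2 a = repr_lin r2 b -> repr_lin r1 a = repr_lin r1 b.
  move=> eq_ab; apply/eqP; rewrite -subr_eq0 -repr_lin_sub; apply/eqP/ann.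
  by rewrite repr_lin_sub eq_ab subrr.
have n2gt0: (0 < n2)%N by case/andP: abs2.
have n1gt0: (0 < n1)%N by case/andP: abs1.
pose i0 := Ordinal n2gt0.
have /fin_all_exists[e De] i := abs_irr_repr_lin abs2 (delta_mx i0 i).
have /fin_all_exists[e' De'] i := abs_irr_repr_lin abs2 (delta_mx i i0).
have nz0: repr_lin r1 (e i0) != 0.
  apply/eqP=> e0.
  (* The elements [e' i * e i0 * e i] act on [r2] as the diagonal matrix units, so their sum acts as
     1 on [r2], hence on [r1]. Therefore [e i0] cannot act as 0 on [r1]. *)
  have: 1%:M = repr_lin r1 (fun g => \sum_i convolution (e' i) (convolution (e i0) (e i)) g).
    rewrite -(repr_lin1 r1); apply: ann2; rewrite repr_lin1 repr_lin_sum.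
    apply/matrixP=> i j; rewrite summxE (bigD1 i) //=.
    rewrite !repr_linM De' !De !mul_delta_mx !mxE eqxx /= eq_sym big1 ?addr0 // => k k'i.
    by rewrite !repr_linM De' !De !mul_delta_mx !mxE [i == k]eq_sym (negPf k'i).
  rewrite repr_lin_sum big1 => [|i _]; last by rewrite !repr_linM e0 mul0mx mulmx0.
  move/matrixP/(_ (Ordinal n1gt0) (Ordinal n1gt0)); rewrite !mxE eqxx.
  by move/eqP; rewrite oner_eq0.
have [k nzk]: exists k, row k (repr_lin r1 (e i0)) != 0.
  by apply/existsP; apply: contraR nz0 => /existsPn/= z; apply/eqP/row_matrixP=> k;
     rewrite row0; apply/eqP/negPn.
pose H := \matrix_i row k (repr_lin r1 (e i)).
have nzH: H != 0.
  by apply: contraNneq nzk => H0; rewrite -[row k _](rowK (fun i => row k (repr_lin r1 (e i)))) -/H H0 row0.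
apply: nsim; apply: mx_rsim_sym; apply: (irr_hom_rsim (H := H)) nzH; try exact: mx_abs_irrW.
move=> g Gg; apply/row_matrixP=> i; rewrite [RHS]row_mul rowK -row_mul.
have Eg n (rG : reprG n): rG g = repr_lin rG (fun h => (h == g)%:R).
  rewrite /repr_lin (bigD1 g) //= eqxx scale1r big1 ?addr0 // => h.
  by case/andP=> _ /negPf->; rewrite scale0r.
rewrite [r1 g]Eg -repr_linM.
rewrite (@ann2 (convolution _ _) (fun h => \sum_j r2 g i j * e j h)); last first.
  rewrite repr_linM De -Eg repr_lin_sum.
  under eq_bigr => j _ do rewrite repr_lin_scale De.
  apply/matrixP=> a b; rewrite summxE mxE (bigD1 i) //= big1 ?addr0; last first.
    by move=> j j'i; rewrite mxE (negPf j'i) andbF mul0r.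
  rewrite (bigD1 b) //= big1 ?addr0; last first.
    by move=> j j'b; rewrite !mxE [b == j]eq_sym (negPf j'b) andbF mulr0.
  by rewrite !mxE !eqxx /= andbT mulrC.
rewrite repr_lin_sum; apply/rowP=> b; rewrite !mxE summxE.
by apply: eq_bigr => j _; rewrite repr_lin_scale !mxE.
Qed.

(** A matrix algebra is simple: if [x] is a nonzero entry of the action of [c] on [r1], in position
    [(i, j)], then the sum over [k] of [E_ki c E_jk] acts on [r1] as the scalar [x], and still as 0
    on [r2]. *)
Lemma not_rsim_separate n1 n2 (r1 : reprG n1) (r2 : reprG n2) :
    mx_absolutely_irreducible r1 -> mx_absolutely_irreducible r2 ->
    ~ mx_rsim r1 r2 ->
  exists c, repr_lin r1 c = 1%:M /\ repr_lin r2 c = 0.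
Proof.
move=> abs1 abs2 nsim; have [c [c2 c1]] := not_rsim_annihilator abs1 abs2 nsim.
have [[i j] nzij]: exists ij, repr_lin r1 c ij.1 ij.2 != 0.
  apply/existsP; apply: contraR c1 => /existsPn z; apply/eqP/matrixP=> i j.
  by rewrite [RHS]mxE; apply/eqP/negPn; apply: (z (i, j)).
set x := repr_lin r1 c _ _ in nzij.
have /fin_all_exists[e De] k := abs_irr_repr_lin abs1 (delta_mx k i).
have /fin_all_exists[e' De'] k := abs_irr_repr_lin abs1 (delta_mx j k).
exists (fun g => \sum_k x^-1 * convolution (e k) (convolution c (e' k)) g).
rewrite !repr_lin_sum; split; last first.
  by rewrite big1 // => k _; rewrite repr_lin_scale !repr_linM c2 mul0mx mulmx0 scaler0.
have E k: delta_mx k i *m (repr_lin r1 c *m delta_mx j k) = x *: delta_mx k k.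
  apply/matrixP=> a b; rewrite !mxE (bigD1 i) //= big1 ?addr0; last first.
    by move=> l l'i; rewrite mxE (negPf l'i) andbF mul0r.
  rewrite !mxE eqxx andbT (bigD1 j) //= big1 ?addr0; last first.
    by move=> l l'j; rewrite mxE (negPf l'j) mulr0.
  by rewrite mxE eqxx /= mulrCA -mulnb natrM.
apply/matrixP=> a b; rewrite summxE (bigD1 a) //= big1 => [|k k'a]; last first.
  by rewrite repr_lin_scale !repr_linM De De' E !mxE [a == k]eq_sym (negPf k'a) !mulr0.
by rewrite repr_lin_scale !repr_linM De De' E !mxE eqxx addr0 mulKf //= eq_sym.
Qed.

(** The identity may have trace 0 in positive characteristic, so the separating element is first cut
    down to a rank-one idempotent on [r1]: its traces are then 1 and 0. *)
Lemma rsim_mxtrace n1 n2 (r1 : reprG n1) (r2 : reprG n2) :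
    mx_absolutely_irreducible r1 -> mx_absolutely_irreducible r2 ->
    {in G, forall g, \tr (r1 g) = \tr (r2 g)} -> mx_rsim r1 r2.
Proof.
move=> abs1 abs2 eq_tr; apply: NNPP => nsim.
have [c [c1 c2]] := not_rsim_separate abs1 abs2 nsim.
have n1gt0: (0 < n1)%N by case/andP: abs1.
pose i := Ordinal n1gt0.
have [d d1] := abs_irr_repr_lin abs1 (delta_mx i i).
have: \tr (repr_lin r1 (convolution c d)) = \tr (repr_lin r2 (convolution c d)).
  by rewrite !mxtrace_repr_lin; apply: eq_bigr => g Gg; rewrite eq_tr.
rewrite !repr_linM c1 c2 d1 mul1mx mul0mx linear0 /mxtrace (bigD1 i) //=.
rewrite mxE eqxx big1 => [|k k'i]; last by rewrite mxE (negPf k'i).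
by rewrite addr0 => /eqP; rewrite oner_eq0.
Qed.

(** Packing the degree lets one list hold representations of different degrees. Properties of its
    members are stated with [List.Forall], which asks for no decidable equality. *)
Definition any_repr := {n : nat & reprG n}.
Definition packed_repr (x : any_repr) : reprG (projT1 x) := projT2 x.
Definition PackRepr n (rG : reprG n) : any_repr := existT _ n rG.

Lemma not_rsim_separate_seq n (r : reprG n) (s : seq any_repr) A :
    mx_absolutely_irreducible r ->
    List.Forall (fun x => mx_absolutely_irreducible (packed_repr x) /\
                          ~ mx_rsim r (packed_repr x)) s ->
  exists c, repr_lin r c = A /\
    List.Forall (fun x => repr_lin (packed_repr x) c = 0) s.
Proof.
move=> absr; elim=> [|x s' [absx nx] _ [c [c1 c0]]].
  by have [c c1] := abs_irr_repr_lin absr A; exists c.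
have [d [d1 d0]] := not_rsim_separate absr absx nx.
exists (convolution d c); rewrite repr_linM d1 mul1mx; split=> //.
constructor; first by rewrite repr_linM d0 mul0mx.
by apply: List.Forall_impl c0 => y c0; rewrite repr_linM c0 mulmx0.
Qed.

End GroupAlgebra.

(** * Composition factors and traces *)

Section Reducible.

Variables (F : fieldType) (gT : finGroupType).

Lemma reducible_submodule (G : {group gT}) n (rG : mx_representation F G n) :
    (0 < n)%N -> ~ mx_irreducible rG ->
  exists2 U : 'M_n, mxmodule rG U & (0 < \rank U < n)%N.
Proof.
move=> n_gt0 redG; apply: NNPP => noU; apply: redG; apply/mxsimpleP.
rewrite mxmodule1 -mxrank_eq0 mxrank1 -lt0n; split=> // -[U /and4P[modU _ nzU ltU]].
by apply: noU; exists U; rewrite // lt0n mxrank_eq0 nzU; rewrite mxrank1 in ltU.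
Qed.

(* [s] lists the composition factors of [rG]. *)
Lemma composition_mxtrace (G : {group gT}) n (rG : mx_representation F G n) :
  exists s : seq (any_repr F G),
    [/\ List.Forall (fun x => mx_irreducible (packed_repr x)) s,
        List.Forall (fun x => projT1 x <= n)%N s,
        ~ mx_irreducible rG -> List.Forall (fun x => projT1 x < n)%N s
      & {in G, forall g, \tr (rG g) = \sum_(x <- s) \tr (packed_repr x g)}].
Proof.
have [m] := ubnP n; elim: m => // m IHm in n rG *; rewrite ltnS => le_nm.
have [n0 | n_gt0] := posnP n.
  exists [::]; split; do ?by constructor.
  move=> g _; rewrite big_nil /mxtrace; apply: big1 => i.
  by have := ltn_ord i; rewrite {2}n0.
have [irrG | redG] := classic (mx_irreducible rG).
  exists [:: PackRepr rG]; split=> //; do ?by constructor; rewrite //=.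
  by move=> g _; rewrite big_seq1.
have [U modU /andP[U_gt0 ltUn]] := reducible_submodule n_gt0 redG.
have ltC: (\rank (cokermx U) < n)%N by rewrite mxrank_coker ltn_subrL n_gt0 U_gt0.
have [s1 [irr1 dim1 _ tr1]] := IHm _ (submod_repr modU) (leq_trans ltUn le_nm).
have [s2 [irr2 dim2 _ tr2]] := IHm _ (factmod_repr modU) (leq_trans ltC le_nm).
have ltn: List.Forall (fun x => projT1 x < n)%N (s1 ++ s2).
  apply/List.Forall_app; split.
    by apply: List.Forall_impl dim1 => x /leq_ltn_trans->.
  by apply: List.Forall_impl dim2 => x /leq_ltn_trans->.
exists (s1 ++ s2); split=> //; first exact/List.Forall_app.
  by apply: List.Forall_impl ltn => x /ltnW.
by move=> g Gg; rewrite big_cat /= -tr1 // -tr2 // mxtrace_sub_fact_mod.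
Qed.

(* The p-core of the cyclic group [<[g]>] acts trivially on its simple modules. *)
Lemma mxtrace_constt p (G : {group gT}) n (rG : mx_representation F G n) g :
  p \in [pchar F] -> g \in G -> \tr (rG g) = \tr (rG g.`_p^').
Proof.
move=> pcharF Gg; have sCG: <[g]> \subset G by rewrite cycle_subG.
have [s [irr_s _ _ tr_s]] := composition_mxtrace (subg_repr rG sCG).
have := tr_s _ (cycle_id g); rewrite /= => ->.
have Cgp': g.`_p^' \in <[g]> by apply: mem_cycle.
have := tr_s _ Cgp'; rewrite /= => ->.
elim: irr_s {tr_s} => [|x s' irrx _ IHs]; first by rewrite !big_nil.
rewrite !big_cons IHs; congr (_ + _).
have: g.`_p \in rker (packed_repr x).
  apply: (subsetP (pcore_sub_rker_mx_irr_pchar pcharF irrx)).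
  have: <[g.`_p]> \subset 'O_p(<[g]>).
    apply: pcore_max; first exact: p_elt_constt.
    by rewrite -sub_abelian_normal ?cycle_abelian // cycle_subG mem_cycle.
  by rewrite cycle_subG.
case/rkerP=> Cgp r1.
have ->: packed_repr x g = packed_repr x (g.`_p * g.`_p^')%g by rewrite consttC.
by rewrite repr_mxM // r1 mul1mx.
Qed.

(** Induction on the degree: given a proper nonzero submodule, restrict to it if it contains the
    image of [A], and otherwise pass to the quotient by it; either way [A] stays nonzero.
    Quantifying over [X] keeps equivariance under any subgroup of [G]. *)
Lemma irreducible_quotient_hom (G : {group gT}) n m (rG : mx_representation F G n)
    (A : 'M_(m, n)) :
    A != 0 ->
  exists k (r : mx_representation F G k) (A' : 'M_(m, k)),
    [/\ mx_irreducible r, A' != 0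
      & {in G, forall g (X : 'M_m), X *m A = A *m rG g -> X *m A' = A' *m r g}].
Proof.
have [d] := ubnP n; elim: d => // d IHd in n rG A *; rewrite ltnS => le_nd nzA.
have n_gt0: (0 < n)%N.
  by rewrite lt0n; apply: contraNneq nzA => n0; apply/eqP/matrixP=> i j;
     have := ltn_ord j; rewrite {2}n0.
have [irrG | redG] := classic (mx_irreducible rG).
  by exists n, rG, A; split.
have [U modU /andP[U_gt0 ltUn]] := reducible_submodule n_gt0 redG.
have [sAU | nsAU] := boolP (A <= U)%MS.
  have nzA': in_submod U A != 0.
    by apply: contraNneq nzA => A0; rewrite -(in_submodK sAU) A0 /val_submod /= mul0mx.
  have [k [r [A' [irr nz hom]]]] := IHd _ (submod_repr modU) _ (leq_trans ltUn le_nd) nzA'.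
  exists k, r, A'; split=> // g Gg X homX; apply: hom => //=.
  by rewrite -in_submodJ // -homX in_submodE [in RHS]in_submodE mulmxA.
have nzA': in_factmod U A != 0 by rewrite in_factmod_eq0.
have ltC: (\rank (cokermx U) < n)%N by rewrite mxrank_coker ltn_subrL n_gt0 U_gt0.
have [k [r [A' [irr nz hom]]]] := IHd _ (factmod_repr modU) _ (leq_trans ltC le_nd) nzA'.
exists k, r, A'; split=> // g Gg X homX; apply: hom => //=.
by rewrite -in_factmodJ // -homX in_factmodE [in RHS]in_factmodE mulmxA.
Qed.

End Reducible.

(** * Characteristic polynomials of direct sums *)

Section DirectSumCharPoly.

Variables (F : fieldType) (d : nat) (A : 'M[F]_d).

Lemma char_poly_intertwine n (B C P : 'M[F]_n) :
  P \in unitmx -> B *m P = P *m C -> char_poly B = char_poly C.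
Proof.
move=> uP BP; have nzP: (\det P)%:P != 0 :> {poly F}.
  by rewrite polyC_eq0 -unitfE -unitmxE.
apply: (mulIf nzP); rewrite -det_map_mx /char_poly -det_mulmx [RHS]mulrC -det_mulmx.
congr (\det _); rewrite /char_poly_mx mulmxBl mulmxBr scalar_mxC.
by rewrite -!map_mxM BP.
Qed.

Lemma char_poly_row_basis k1 k2 (Q1 : 'M[F]_(k1, d)) (Q2 : 'M[F]_(k2, d)) C1 C2 :
    row_free Q1 -> row_free Q2 -> (Q1 :=: Q2)%MS ->
    Q1 *m A = C1 *m Q1 -> Q2 *m A = C2 *m Q2 ->
  char_poly C1 = char_poly C2.
Proof.
move=> free1 free2 eqQ.
have eqk: k1 = k2 by rewrite -(eqP free1) -(eqP free2) eqQ.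
case: k2 / eqk in Q2 C2 free2 eqQ * => Q1A Q2A.
have [P def1]: exists P, Q1 = P *m Q2 by apply/submxP; rewrite eqQ.
apply: (char_poly_intertwine (P := P)).
  by rewrite -row_free_unit -row_leq_rank -{1}(eqP free1) def1 mxrankM_maxl.
by apply: (row_free_inj free2); rewrite -!mulmxA -Q2A -def1 -Q1A def1 mulmxA.
Qed.

(** The dimension count forces the sum to be direct, so the stacked [Q i] form a basis in which [A]
    is block diagonal. *)
Lemma char_poly_dsum (I : Type) (r : seq I) k (Q : I -> 'M[F]_(k, d)) C :
    (forall i, Q i *m A = C i *m Q i) ->
    (\sum_(i <- r) <<Q i>> :=: 1%:M)%MS -> d = (size r * k)%N ->
  char_poly A = \prod_(i <- r) char_poly (C i).
Proof.
move=> QA sum1 dim.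
have: \rank (\sum_(i <- r) <<Q i>>)%MS = (size r * k)%N by rewrite sum1 mxrank1.
(* For the induction, spanning the whole space is weakened to having the largest possible rank, a
   property inherited by the tail of the list. *)
have: exists m (T : 'M[F]_(m, d)) B,
   \rank (\sum_(i <- r) <<Q i>>)%MS = (size r * k)%N ->
   [/\ row_free T, (T :=: \sum_(i <- r) <<Q i>>)%MS, T *m A = B *m T
     & char_poly B = \prod_(i <- r) char_poly (C i)].
  elim: r {sum1 dim} => [|i r [m [T [B IH]]]].
    exists 0%N, 0, 0 => _; rewrite !big_nil /row_free mxrank0 !mul0mx.
    by split=> //; [exact: eqmx0 | rewrite /char_poly det_mx00].
  exists (k + m)%N, (col_mx (Q i) T), (block_mx (C i) 0 0 B) => rk.
  have leQ: (\rank <<Q i>> <= k)%N by rewrite genmxE rank_leq_row.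
  have leS: (\rank (\sum_(j <- r) <<Q j>>)%MS <= size r * k)%N.
    elim: (r) => [|j r' IHr]; first by rewrite big_nil mxrank0.
    rewrite big_cons (leq_trans (mxrank_adds_leqif _ _)) // mulSn leq_add //.
    by rewrite genmxE rank_leq_row.
  rewrite big_cons in rk; have := mxrank_adds_leqif <<Q i>>%MS (\sum_(j <- r) <<Q j>>)%MS.
  case=> + _; rewrite rk /= mulSn => le_rk.
  have rkS: \rank (\sum_(j <- r) <<Q j>>)%MS = (size r * k)%N.
    apply/eqP; rewrite eqn_leq leS -(leq_add2l k) (leq_trans le_rk) //.
    by rewrite leq_add2r.
  have [freeT eqT TA cB] := IH rkS.
  have eqm: m = (size r * k)%N by rewrite -(eqP freeT) eqT.
  have eqC: (col_mx (Q i) T :=: \sum_(j <- i :: r) <<Q j>>)%MS.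
    rewrite big_cons; apply: eqmx_trans (eqmx_sym (addsmxE _ _)) _.
    by apply: adds_eqmx eqT; apply: eqmx_sym; apply: genmxE.
  split=> //; first by rewrite /row_free eqC big_cons rk /= mulSn eqm.
    by rewrite mul_col_mx mul_block_col !mul0mx addr0 add0r QA TA.
  by rewrite big_cons -cB /char_poly char_block_diag_mx det_ublock.
case=> m [T [B IH]] /IH[freeT eqT TA <-]; symmetry.
apply: (char_poly_row_basis (Q1 := T) (Q2 := 1%:M)) => //.
- by rewrite row_free_unit unitmx1.
- exact: eqmx_trans eqT sum1.
- by rewrite mul1mx mulmx1.
Qed.

End DirectSumCharPoly.

Section CharTwo.

Variable F : fieldType.
Hypothesis pcharF : 2 \in [pchar F].

Lemma sqr_inj_pchar2 (a b : F) : a ^+ 2 = b ^+ 2 -> a = b.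
Proof. by move=> eq_ab; apply: (fmorph_inj (pFrobenius_aut pcharF)). Qed.

End CharTwo.

(** * Conjugate and dual representations, invariant forms *)

Section TwistedRepr.

Variables (F : fieldType) (gT : finGroupType) (G : {group gT}).
Local Notation reprG := (mx_representation F G).

Lemma conj_mx_repr n (r : reprG n) x : x \in 'N(G) -> mx_repr G (fun g => r (g ^ x^-1)%g).
Proof.
move=> nGx; split=> [|g h Gg Gh]; first by rewrite conj1g repr_mx1.
by rewrite conjMg repr_mxM // memJ_norm ?groupV.
Qed.

Definition conj_repr n (r : reprG n) x (nGx : x \in 'N(G)) :=
  MxRepresentation (conj_mx_repr r nGx).

Lemma conj_repr_irr n (r : reprG n) x (nGx : x \in 'N(G)) :
  mx_irreducible r -> mx_irreducible (conj_repr r nGx).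
Proof.
move=> /mx_irrP[n_gt0 irr]; apply/mx_irrP; split=> // U modU; apply: irr.
apply/mxmoduleP=> g Gg; rewrite -(conjgK x g).
by apply: (mxmoduleP modU); rewrite memJ_norm.
Qed.

Lemma dual_mx_repr n (r : reprG n) : mx_repr G (fun g => (r g^-1%g)^T).
Proof.
split=> [|g h Gg Gh]; first by rewrite invg1 repr_mx1 trmx1.
by rewrite invMg repr_mxM ?groupV // trmx_mul.
Qed.

Definition dual_repr n (r : reprG n) := MxRepresentation (dual_mx_repr r).

Lemma dual_repr_abs_irr n (r : reprG n) :
  mx_absolutely_irreducible r -> mx_absolutely_irreducible (dual_repr r).
Proof.
case/mx_abs_irrP=> n_gt0 [a defA]; apply/mx_abs_irrP; split=> //.
exists (fun g A => a g^-1%g A^T) => A; rewrite -[LHS]trmxK [in LHS](defA A^T).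
rewrite linear_sum (reindex_inj invg_inj) /=; apply: eq_big => [g | g _].
  by rewrite groupV.
by rewrite linearZ.
Qed.

Lemma mx_rsim_dual n1 n2 (r1 : reprG n1) (r2 : reprG n2) :
  mx_rsim r1 (dual_repr r2) -> mx_rsim r2 (dual_repr r1).
Proof.
case=> H eq_n freeH homH; case: n2 / eq_n in r2 H freeH homH *.
rewrite row_free_unit in freeH.
exists H^T => // [|g Gg]; first by rewrite row_free_unit unitmx_tr.
have := homH _ (groupVr Gg); rewrite /= invgK => /(congr1 trmx).
by rewrite !trmx_mul trmxK.
Qed.

Lemma abs_irr_hom_scale n (r s : reprG n) (X Y : 'M_n) :
    mx_absolutely_irreducible r -> X \in unitmx ->
    {in G, forall g, r g *m X = X *m s g} -> {in G, forall g, r g *m Y = Y *m s g} ->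
  exists a, Y = a *: X.
Proof.
move=> absr uX homX homY.
have /is_scalar_mxP[a defa]: is_scalar_mx (Y *m invmx X).
  apply: (mx_abs_irr_cent_scalar absr); apply/centgmxP=> g Gg.
  rewrite [RHS]mulmxA homY // -!mulmxA; congr (_ *m _).
  by apply: (canLR (mulKmx uX)); rewrite mulmxA -homX // mulmxK.
by exists a; rewrite -mul_scalar_mx -defa mulmxKV.
Qed.

Definition invariant_form n (r : reprG n) (B : 'M_n) :=
  {in G, forall g, r g *m B *m (r g)^T = B}.

Lemma invariant_formP n (r : reprG n) B :
  invariant_form r B <-> {in G, forall g, r g *m B = B *m dual_repr r g}.
Proof.
split=> invB g Gg.
  by rewrite -{2}(invB g Gg) /= -!mulmxA -trmx_mul -repr_mxM ?groupV // mulVg repr_mx1 trmx1 mulmx1.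
by rewrite invB //= -mulmxA -trmx_mul -repr_mxM ?groupV // mulgV repr_mx1 trmx1 mulmx1.
Qed.

Lemma invariant_form_scale n (r : reprG n) B C :
    mx_absolutely_irreducible r -> B \in unitmx ->
    invariant_form r B -> invariant_form r C ->
  exists a, C = a *: B.
Proof.
by move=> absr uB /invariant_formP iB /invariant_formP; apply: abs_irr_hom_scale.
Qed.

Lemma self_dual_invariant_form n (r : reprG n) :
    mx_absolutely_irreducible r -> {in G, forall g, \tr (r g^-1%g) = \tr (r g)} ->
  exists2 B, B \in unitmx & invariant_form r B.
Proof.
move=> absr trV; have [g Gg|B _ freeB homB] := rsim_mxtrace absr (dual_repr_abs_irr absr).
  by rewrite mxtrace_tr trV.
by exists B; [rewrite -row_free_unit | apply/invariant_formP].
Qed.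

(** By Schur's lemma [B^T] is [a *: B]; transposing twice gives [a ^+ 2 = 1], and 1 is its own only
    square root in characteristic 2. *)
Lemma invariant_form_sym n (r : reprG n) B :
    2 \in [pchar F] -> mx_absolutely_irreducible r -> B \in unitmx ->
  invariant_form r B -> B^T = B.
Proof.
move=> pcharF absr uB iB.
have [|a defBT] := invariant_form_scale (C := B^T) absr uB iB.
  by move=> g Gg; rewrite -[in RHS](iB g Gg) !trmx_mul trmxK mulmxA.
have n_gt0: (0 < n)%N by case/andP: absr.
have nzB: B != 0.
  apply: contraTneq uB => ->; by rewrite -row_free_unit /row_free mxrank0 eq_sym -lt0n.
have: (a ^+ 2) *: B = 1 *: B.
  by rewrite expr2 -scalerA -defBT scale1r -[RHS]trmxK {2}defBT linearZ.
move/eqP; rewrite -subr_eq0 -scalerBl scaler_eq0 (negPf nzB) orbF subr_eq0.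
rewrite -(expr1n F 2) => /eqP/(sqr_inj_pchar2 pcharF) a1.
by rewrite defBT a1 scale1r.
Qed.

End TwistedRepr.

(** * Clifford decomposition by translates of an embedding *)

Section CliffordBasis.

Variables (F : fieldType) (gT : finGroupType) (G N : {group gT}).
Hypothesis nsNG : N <| G.
Variables (d n : nat) (rG : mx_representation F G d) (r : mx_representation F N n).
Hypotheses (irrG : mx_irreducible rG) (irrN : mx_irreducible r).
Variable f : 'M[F]_(n, d).
Hypothesis homf : {in N, forall h, r h *m f = f *m rG h}.
Hypothesis nzf : f != 0.

Lemma irr_hom_free : row_free f.
Proof.
rewrite -kermx_eq0; apply: contraR nzf => nzK.
have /row_fullP[L LK]: row_full (kermx f).
  have [_ irr] := (mx_irrP r).1 irrN; apply: irr nzK.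
  apply/mxmoduleP=> g Gg; apply/sub_kermxP.
  by rewrite -mulmxA homf // mulmxA mulmx_ker mul0mx.
by rewrite -[f]mul1mx -LK -mulmxA mulmx_ker mulmx0.
Qed.

Lemma irr_hom_image_simple : mxsimple (subg_repr rG (normal_sub nsNG)) <<f>>%MS.
Proof.
split.
- apply/mxmoduleP=> h Nh; rewrite genmxE (eqmxMr _ (genmxE f)) /=.
  by rewrite -homf // submxMl.
- by rewrite -submx0 genmxE submx0.
move=> U modU; rewrite genmxE => /submxP[L defU] nzU; rewrite genmxE.
have fullL: row_full <<L>>%MS.
  have [_ irr] := (mx_irrP r).1 irrN; apply: irr.
    apply/mxmoduleP=> h Nh; rewrite genmxE (eqmxMr _ (genmxE L)).
    rewrite -(submxMfree _ _ irr_hom_free) -mulmxA homf // mulmxA -defU.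
    exact: (mxmoduleP modU).
  rewrite -submx0 genmxE submx0; apply: contraNneq nzU => L0.
  by rewrite defU L0 mul0mx.
rewrite defU -{1}[f]mul1mx submxMr // -(genmxE L) submx_full //.
Qed.

Lemma Clifford_hom_basis :
  exists X : {set gT},
    [/\ X \subset G, (\sum_(x in X) <<f *m rG x>> :=: 1%:M)%MS, d = (#|X| * n)%N
      & {in X, forall x,
          (<<f *m rG x>> :&: \sum_(y in X | y != x) <<f *m rG y>> = 0)%MS}].
Proof.
have [X sXG [sum1 dx]] := Clifford_basis irrG irr_hom_image_simple.
have eqW x: (<<f>> *m rG x :=: <<f *m rG x>>)%MS.
  apply: eqmx_trans (eqmx_sym (genmxE _)); exact: eqmxMr (genmxE f).
exists X; split=> //.
- apply: eqmx_trans sum1; apply: eqmx_sums => x _; exact: eqmx_sym (eqW x).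
- rewrite -(mxrank1 F d) -sum1 (mxdirectP dx) /= -sum_nat_const.
  apply: eq_bigr => x Xx; rewrite mxrankMfree ?repr_mx_free ?(subsetP sXG) //.
  by rewrite genmxE (eqP irr_hom_free).
move=> x Xx; have /mxdirect_sumsP/(_ x Xx) dxx := dx.
apply/eqP; rewrite -submx0 -[X in (_ <= X)%MS]dxx capmxS ?eqW //.
by apply/sumsmx_subP=> y XPy; rewrite -eqW (sumsmx_sup y).
Qed.

End CliffordBasis.

(** * Lifting eigenvalues and Brauer characters *)

Section RootsOfUnity.

Variables (R : idomainType).

Lemma tofrac_inj : injective (@FracField.tofrac R).
Proof.
by move=> a b /eqP; rewrite -subr_eq0 -tofracB tofrac_eq0 subr_eq0 => /eqP.
Qed.

Lemma fractionP (z : {fraction R}) :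
  exists a b : R, b != 0 /\ z = FracField.tofrac a / FracField.tofrac b.
Proof.
elim/quotW: z => x; have nzd := denom_ratioP x.
exists (frac x).1, (frac x).2; split=> //.
apply: (canRL (mulfK _)); first by rewrite tofrac_eq0.
unlock FracField.tofrac; rewrite -[LHS]FracField.pi_mul; apply/eqmodP.
rewrite /= FracField.equivfE /FracField.mulf.
by rewrite !numden_Ratio ?(oner_neq0, mul1r, mulr1) // mulrC.
Qed.

(* A root of unity in the field of fractions of a discrete valuation ring has *)
(* valuation 0.                                                              *)
Lemma dvr_root_of_unity k (z : {fraction R}) :
    complete_dvr R -> (0 < k)%N -> z ^+ k = 1 ->
  exists w : R, z = FracField.tofrac w.
Proof.
case=> pi [[nzpi _ dec] _] k_gt0 zk.
have [a [b [nzb defz]]] := fractionP z.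
have nza: a != 0.
  apply: contraTneq (oner_neq0 {fraction R}) => a0.
  by rewrite -zk defz a0 tofrac0 mul0r expr0n gtn_eqF // eqxx.
have [i [u Uu defa]] := dec a nza; have [j [v Uv defb]] := dec b nzb.
have nzF (x : R) : x != 0 -> FracField.tofrac x != 0 by rewrite tofrac_eq0.
have nzU (x : R) : x \is a GRing.unit -> x != 0.
  by apply: contraTneq => ->; rewrite unitr0.
have dvd_case c d s t m n : s \is a GRing.unit -> t \is a GRing.unit ->
    c = s * pi ^+ m -> d = t * pi ^+ n -> (n <= m)%N ->
    exists w : R, FracField.tofrac c / FracField.tofrac d = FracField.tofrac w.
  move=> Us Ut -> -> le_nm; exists (s / t * pi ^+ (m - n)).
  have nzd: FracField.tofrac (t * pi ^+ n) != 0.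
    by apply/nzF/mulf_neq0; [apply: nzU | apply: expf_neq0].
  apply: (mulIf nzd); rewrite divfK // -tofracM; congr FracField.tofrac.
  by rewrite -{1}(subnK le_nm) exprD [RHS]mulrACA divrK.
case: (leqP j i) => [le_ji | /ltnW le_ij].
  by have [w] := dvd_case _ _ _ _ _ _ Uu Uv defa defb le_ji; exists w; rewrite defz.
have [w defw] := dvd_case _ _ _ _ _ _ Uv Uu defb defa le_ij.
exists (w ^+ k.-1); rewrite rmorphXn /= -defw.
have nzz: z != 0 by rewrite defz mulf_neq0 ?invr_eq0 ?nzF.
have ->: FracField.tofrac b / FracField.tofrac a = z^-1 by rewrite defz invf_div.
by apply: (mulIf (expf_neq0 k.-1 nzz)); rewrite exprVn mulVf ?expf_neq0 // -exprS prednK.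
Qed.

Lemma primitive_root_tofrac k (w : R) :
  k.-primitive_root (FracField.tofrac w) = k.-primitive_root w.
Proof.
congr (_ && _); apply: eq_forallb => i.
by rewrite !unity_rootE -(inj_eq tofrac_inj) rmorphXn rmorph1.
Qed.

Lemma prod_primitive_root_domain k (z : R) :
  k.-primitive_root z -> \prod_(0 <= i < k) ('X - (z ^+ i)%:P) = 'X^k - 1.
Proof.
rewrite -primitive_root_tofrac => prim_z.
apply: (map_inj_poly tofrac_inj (tofrac0 R)).
rewrite [RHS]raddfB /= map_polyXn rmorph1 map_prod_XsubC.
by under eq_bigr do rewrite rmorphXn; apply: factor_Xn_sub_1.
Qed.

Lemma unity_root_domain k (z x : R) :
  k.-primitive_root z -> x ^+ k = 1 -> exists i : 'I_k, x = z ^+ i.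
Proof.
rewrite -primitive_root_tofrac => prim_z xk.
have [|i Dx] := prim_rootP prim_z (x := FracField.tofrac x).
  by rewrite -rmorphXn /= xk rmorph1.
by exists i; apply: tofrac_inj; rewrite rmorphXn.
Qed.

(** Since [k] is nonzero in [F], the polynomial ['X^k - 1] is separable there, so the [k] powers of
    [red z] stay distinct. *)
Lemma primitive_root_reduction (F : fieldType) (red : {rmorphism R -> F}) k (z : R) :
  k%:R != 0 :> F -> k.-primitive_root z -> k.-primitive_root (red z).
Proof.
move=> nzk prim_z; have k_gt0 := prim_order_gt0 prim_z.
have rzk: red z ^+ k = 1 by rewrite -rmorphXn (prim_expr_order prim_z) rmorph1.
have: uniq [seq red z ^+ i | i <- index_iota 0 k].
  rewrite -separable.separable_prod_XsubC big_map.
  have <-: 'X^k - 1 = \prod_(0 <= i < k) ('X - (red z ^+ i)%:P).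
    have := congr1 (map_poly red) (prod_primitive_root_domain prim_z).
    rewrite [RHS]raddfB /= map_polyXn rmorph1 map_prod_XsubC => <-.
    by apply: eq_bigr => i _; rewrite rmorphXn.
  exact: cyclotomic.separable_Xn_sub_1.
have [m prim_rz m_dvd] := prim_order_exists k_gt0 rzk => uniq_rz.
suffices ->: k = m by [].
apply/eqP; rewrite eqn_leq [(m <= k)%N]dvdn_leq // andbT leqNgt; apply/negP=> lt_mk.
have /uniqP := uniq_rz => /(_ 0 0%N m); rewrite !inE size_map size_iota subn0.
rewrite k_gt0 lt_mk !(nth_map 0%N) ?size_iota ?subn0 // !nth_iota ?subn0 // !add0n.
rewrite expr0 (prim_expr_order prim_rz) => /(_ isT isT erefl) m0.
by have := prim_order_gt0 prim_rz; rewrite -m0.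
Qed.

End RootsOfUnity.

Section BrauerLift.

Variables (R : idomainType) (F : fieldType) (red : {rmorphism R -> F}) (k : nat).

(** This is the condition of [brauer_char_of] at one element of order [k], for an arbitrary
    polynomial in place of a characteristic polynomial, so that it is compatible with products. *)
Definition brauer_lift (P : {poly F}) (a : R) :=
  exists s : seq R,
    [/\ forall z : R, z \in s -> z ^+ k = 1,
        P = \prod_(z <- s) ('X - (red z)%:P) & a = \sum_(z <- s) z].

Lemma brauer_lift1 : brauer_lift 1 0.
Proof. by exists [::]; rewrite !big_nil. Qed.

Lemma brauer_liftM P Q a b :
  brauer_lift P a -> brauer_lift Q b -> brauer_lift (P * Q) (a + b).
Proof.
move=> [s [s1 -> ->]] [t [t1 -> ->]]; exists (s ++ t); rewrite !big_cat; split=> // z.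
by rewrite mem_cat => /orP[/s1 | /t1].
Qed.

Lemma brauer_lift_prod (I : eqType) (r : seq I) P a :
    {in r, forall i, brauer_lift (P i) (a i)} ->
  brauer_lift (\prod_(i <- r) P i) (\sum_(i <- r) a i).
Proof.
elim: r => [|i r IHr] lifts; first by rewrite !big_nil; apply: brauer_lift1.
rewrite !big_cons; apply: brauer_liftM; first exact/lifts/mem_head.
by apply: IHr => j rj; apply: lifts; rewrite inE rj orbT.
Qed.

Lemma brauer_lift_trace n (A : 'M[F]_n) a :
  brauer_lift (char_poly A) a -> \tr A = red a.
Proof.
case=> s [_ defP ->].
have sz: size s = n.
  have := size_char_poly A; rewrite defP -(big_map red predT (fun z => 'X - z%:P)).
  by rewrite size_prod_XsubC size_map => -[].
have [n0 | n_gt0] := posnP n.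
  rewrite n0 in sz; rewrite (size0nil sz) big_nil rmorph0 /mxtrace big1 // => i.
  by have := ltn_ord i; rewrite {2}n0.
apply: oppr_inj; rewrite -char_poly_trace // defP -(big_map red predT (fun z => 'X - z%:P)).
by rewrite -sz -(size_map red) coefPn_prod_XsubC ?size_map ?sz -?lt0n // big_map -rmorph_sum.
Qed.

Lemma brauer_lift_degree n (A : 'M[F]_n) a :
  k = 1%N -> brauer_lift (char_poly A) a -> a = n%:R.
Proof.
move=> k1 [s [s1 defP ->]].
have <-: size s = n.
  have := size_char_poly A; rewrite defP -(big_map red predT (fun z => 'X - z%:P)).
  by rewrite size_prod_XsubC size_map => -[].
rewrite (eq_big_seq (fun=> 1)) => [|z sz]; last by rewrite -(s1 z sz) k1 expr1.
by rewrite big_const_seq count_predT iter_addr addr0.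
Qed.

Variable z : R.
Hypotheses (prim_z : k.-primitive_root z) (nzk : k%:R != 0 :> F).

Let prim_rz := primitive_root_reduction red nzk prim_z.

Lemma brauer_lift_uniq P a b : brauer_lift P a -> brauer_lift P b -> a = b.
Proof.
(* [lift] inverts [red] on the [k]-th roots of unity; so the sum of the lifts depends only on the
   multiset of roots of [P]. *)
pose lift (y : F) := z ^+ index y [seq red z ^+ i | i <- index_iota 0 k].
have k_gt0 := prim_order_gt0 prim_z.
have liftK w: w ^+ k = 1 -> lift (red w) = w.
  case/(unity_root_domain prim_z)=> i ->; rewrite rmorphXn /lift; congr (_ ^+ _).
  rewrite -[in LHS](add0n i) -(@nth_iota 0 0%N k) // -(@nth_map _ 0%N _ 0 (GRing.exp (red z))); last first.
    by rewrite size_iota.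
  have -> : iota 0 k = index_iota 0 k by rewrite /index_iota subn0.
  rewrite index_uniq ?size_map ?size_iota ?subn0 // map_inj_in_uniq ?iota_uniq // => x y.
  rewrite !mem_index_iota /= => ltx lty /eqP.
  by rewrite (eq_prim_root_expr prim_rz) !modn_small // => /eqP.
have lift_sum s: (forall w, w \in s -> w ^+ k = 1) ->
    \sum_(w <- s) w = \sum_(y <- map red s) lift y.
  by move=> s1; rewrite big_map; apply: eq_big_seq => w /s1/liftK->.
case=> s [s1 defP ->] [t [t1 defP' ->]]; rewrite (lift_sum s) // (lift_sum t) //.
apply: perm_big; apply: prod_XsubC_eq.
by rewrite !big_map -defP defP'.
Qed.

(** [A] is annihilated by ['X^k - 1], which splits over [F] with simple roots, so it is
    diagonalizable with powers of [red z] as eigenvalues. *)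
Lemma brauer_lift_exists n (A : 'M[F]_n.+1) :
  A ^+ k = 1 -> exists a, brauer_lift (char_poly A) a.
Proof.
move=> Ak; have k_gt0 := prim_order_gt0 prim_z.
pose rs := [seq red z ^+ i | i <- index_iota 0 k].
have prod_rs: \prod_(x <- rs) ('X - x%:P) = 'X^k - 1.
  by rewrite -(factor_Xn_sub_1 prim_rz) big_map.
have [P uP /similar_diagPex[D /(similarP uP) PA]]: diagonalizable A.
  apply/diagonalizableP; exists rs.
    rewrite -separable.separable_prod_XsubC prod_rs.
    exact: cyclotomic.separable_Xn_sub_1.
  rewrite prod_rs; apply: mxminpoly_min.
  by rewrite rmorphB rmorphXn /= horner_mx_X rmorph1 Ak subrr.
have Dk i: D 0 i ^+ k = 1.
  have: diag_mx D ^+ k = 1.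
    have PAX m: P *m A ^+ m = diag_mx D ^+ m *m P.
      elim: m => [|m IHm]; first by rewrite !expr0 mulmx1 mul1mx.
      by rewrite !exprSr [P *m _]mulmxA IHm -!mulmxA PA.
    have := PAX k; rewrite Ak mulmx1 => /esym/(canRL (mulmxK uP)) ->.
    by rewrite mulmxV.
  have -> m: diag_mx D ^+ m = diag_mx (\row_j (D 0 j ^+ m)).
    elim: m => [|m IHm].
      by rewrite expr0; apply/matrixP=> a b; rewrite !mxE expr0.
    rewrite exprSr IHm; apply/matrixP=> a b; rewrite mxE (bigD1 a) //= big1.
      by rewrite !mxE eqxx addr0 exprSr; case: eqP => [->|_]; rewrite ?mulr1n ?mulr0n ?mulr0.
    by move=> c c'a; rewrite !mxE [a == c]eq_sym (negPf c'a) mulr0n mul0r.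
  by move/matrixP/(_ i i); rewrite !mxE eqxx mulr1n.
have /fin_all_exists[e De] i: exists j : 'I_k, D 0 i = red z ^+ j.
  by have [j Dj] := prim_rootP prim_rz (Dk i); exists j.
exists (\sum_(w <- [seq z ^+ e i | i <- enum 'I_n.+1]) w).
exists [seq z ^+ e i | i <- enum 'I_n.+1]; split=> //.
  by move=> _ /mapP[i _ ->]; rewrite exprAC (prim_expr_order prim_z) expr1n.
rewrite (char_poly_intertwine (B := A) (C := diag_mx D) (P := invmx P)) ?unitmx_inv //.
  rewrite char_poly_trig ?diag_mx_is_trig // big_map big_enum /=.
  by apply: eq_bigr => i _; rewrite mxE eqxx mulr1n De rmorphXn.
by apply: (canLR (mulmxK uP)); rewrite -mulmxA -PA mulKmx.
Qed.

End BrauerLift.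

(** * Brauer characters and the modules affording them *)

Section BrauerCharactersOfRepresentations.

Variables (p : nat) (R : idomainType) (F : fieldType) (red : {rmorphism R -> F}).
Hypothesis hsys : modular_system p red.
Variables (gT : finGroupType) (G : {group gT}).
Hypotheses (hK : splits_subgroups {fraction R} G) (hF : splits_subgroups F G).

Local Notation brauer_of := (brauer_char_of p red).

Lemma irr_abs_irr (H : {group gT}) n (r : mx_representation F H n) :
  H \subset G -> mx_irreducible r -> mx_absolutely_irreducible r.
Proof. by move=> sHG; apply: hF. Qed.

(** A splitting field of characteristic 0 for [<[g]>] contains such a root, and [dvr_root_of_unity]
    brings it down from the field of fractions to [R]. *)
Lemma elt_primitive_root g :
  g \in G -> exists z : R, #[g].-primitive_root z.
Proof.
move=> Gg; apply: NNPP => no_z.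
have sCG: <[g]> \subset G by rewrite cycle_subG.
have := splitting_cyclic_primitive_root_pchar (cycle_cyclic g) _ (hK sCG).
suffices: [pchar {fraction R}]^'.-group <[g]>.
  (* The root is provided only classically, so it is used against the boolean goal [false]. *)
  move=> K'g /(_ K'g) IH; suffices: false by []; apply: (IH false) => -[z prim_z].
  have [|w defz] := dvr_root_of_unity (modsys_dvr hsys) (order_gt0 g) (z := z).
    exact: prim_expr_order prim_z.
  by case: no_z; exists w; rewrite -primitive_root_tofrac -defz.
by apply/pgroupP=> q _ _; rewrite inE /= (modsys_pchar0 hsys).
Qed.

Lemma p'elt_order_neq0 (g : gT) : p^'.-elt g -> #[g]%:R != 0 :> F.
Proof.
move=> p'g; rewrite -(dvdn_pcharf (modsys_pchar hsys)) -p'natE //.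
exact: pcharf_prime (modsys_pchar hsys).
Qed.

Lemma char_poly_rsim (H : {group gT}) n1 n2 (r1 : mx_representation F H n1)
    (r2 : mx_representation F H n2) :
  mx_rsim r1 r2 -> {in H, forall g, char_poly (r1 g) = char_poly (r2 g)}.
Proof.
case=> B eq_n freeB homB g Hg; case: n2 / eq_n in r2 B freeB homB *.
by apply: (char_poly_intertwine (P := B)); rewrite -?row_free_unit ?homB.
Qed.

Lemma brauer_of_char_poly (H : {group gT}) n1 n2 (r1 : mx_representation F H n1)
    (r2 : mx_representation F H n2) theta :
    {in H, forall g, char_poly (r1 g) = char_poly (r2 g)} ->
  brauer_of r1 theta -> brauer_of r2 theta.
Proof.
move=> eq_cp th g; move: (th g); case: ifP => // /andP[Hg _].
by rewrite eq_cp.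
Qed.

Lemma brauer_of_lift (H : {group gT}) n (r : mx_representation F H n) theta g :
    brauer_of r theta -> g \in H -> p^'.-elt g ->
  brauer_lift red #[g] (char_poly (r g)) (theta g).
Proof. by move=> th Hg p'g; have := th g; rewrite Hg p'g. Qed.

Lemma brauer_of_out (H : {group gT}) n (r : mx_representation F H n) theta g :
  brauer_of r theta -> ~~ ((g \in H) && p^'.-elt g) -> theta g = 0.
Proof. by move=> th /negPf out; have := th g; rewrite out. Qed.

Lemma brauer_of_uniq (H : {group gT}) n (r : mx_representation F H n)
    (theta theta' : {ffun gT -> R}) :
    H \subset G -> brauer_of r theta ->
    (forall g, if (g \in H) && p^'.-elt g
               then brauer_lift red #[g] (char_poly (r g)) (theta' g)
               else theta' g = 0) ->
  theta = theta'.
Proof.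
move=> sHG th th'; apply/ffunP=> g; move: (th g) (th' g).
case: ifP => [/andP[Hg p'g] | _ -> -> //].
have [z prim_z] := elt_primitive_root (subsetP sHG g Hg).
exact: (brauer_lift_uniq prim_z (p'elt_order_neq0 p'g)).
Qed.

Lemma brauer_of_exists (H : {group gT}) n (r : mx_representation F H n) :
  H \subset G -> exists theta, brauer_of r theta.
Proof.
move=> sHG; have [n0 | n_gt0] := posnP n.
  exists 0 => g; case: ifP => [_ | _]; last by rewrite ffunE.
  subst n; exists [::]; rewrite !big_nil ffunE; split=> //.
  by rewrite /char_poly det_mx00.
case: n n_gt0 r => // n _ r.
have /fin_all_exists[th th_lift] g: exists a,
    if (g \in H) && p^'.-elt g then brauer_lift red #[g] (char_poly (r g)) a else a = 0.
  have [/andP[Hg p'g] | _] := boolP ((g \in H) && _); last by exists 0.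
  have [z prim_z] := elt_primitive_root (subsetP sHG g Hg).
  have [|a lift_a] := brauer_lift_exists red prim_z (p'elt_order_neq0 p'g) (A := r g).
    by rewrite -(repr_mxX r) // expg_order; apply: repr_mx1.
  by exists a.
by exists [ffun g => th g] => g; rewrite ffunE; apply: th_lift.
Qed.

Lemma brauer_of_mxtrace (H : {group gT}) n (r : mx_representation F H n) theta g :
  brauer_of r theta -> g \in H -> \tr (r g) = red (theta g.`_p^').
Proof.
move=> th Hg; rewrite (mxtrace_constt _ (modsys_pchar hsys)) //.
have Hgp': g.`_p^' \in H by apply: groupX.
apply: brauer_lift_trace (brauer_of_lift th Hgp' _); exact: p_elt_constt.
Qed.

Lemma brauer_of_degree (H : {group gT}) n (r : mx_representation F H n) theta :
  brauer_of r theta -> theta 1%g = n%:R.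
Proof.
move=> th; apply: brauer_lift_degree (brauer_of_lift th (group1 H) _).
  exact: order1.
by rewrite /p_elt order1.
Qed.

Lemma brauer_of_dim (H1 H2 : {group gT}) n1 n2 (r1 : mx_representation F H1 n1)
    (r2 : mx_representation F H2 n2) theta1 theta2 :
    brauer_of r1 theta1 -> brauer_of r2 theta2 -> theta1 1%g = theta2 1%g ->
  n1 = n2.
Proof.
move=> th1 th2; rewrite (brauer_of_degree th1) (brauer_of_degree th2).
have inj m: (m%:R == 0 :> R) = (m == 0)%N.
  rewrite -(inj_eq (@tofrac_inj R)) rmorph_nat rmorph0.
  by have /pcharf0P-> := modsys_pchar0 hsys.
wlog le12: n1 n2 {r1 r2 th1 th2} / (n1 <= n2)%N => [IH | /esym/eqP].
  by case: (leqP n1 n2) => [/IH // | /ltnW le21 /esym/(IH _ _ le21)->].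
rewrite -subr_eq0 -natrB // inj subn_eq0 => le21.
by apply/eqP; rewrite eqn_leq le12.
Qed.

Lemma brauer_of_rsim (H : {group gT}) n1 n2 (r1 : mx_representation F H n1)
    (r2 : mx_representation F H n2) theta :
    H \subset G -> mx_irreducible r1 -> mx_irreducible r2 ->
  brauer_of r1 theta -> brauer_of r2 theta -> mx_rsim r1 r2.
Proof.
move=> sHG irr1 irr2 th1 th2; apply: rsim_mxtrace; try exact: irr_abs_irr.
by move=> g Hg; rewrite (brauer_of_mxtrace th1) // (brauer_of_mxtrace th2).
Qed.

Lemma brauer_of_self_dual (H : {group gT}) n (r : mx_representation F H n) theta B :
    H \subset G -> brauer_of r theta -> B \in unitmx -> invariant_form r B ->
  self_dual theta.
Proof.
move=> sHG th uB iB; apply: (brauer_of_uniq sHG th) => g.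
rewrite ffunE -groupV -p_eltV; move: (th g^-1%g); case: ifP => //.
case/andP; rewrite groupV orderV => Hg _.
suffices ->: char_poly (r g^-1%g) = char_poly (r g) by [].
have /invariant_formP homB := iB.
rewrite (char_poly_intertwine uB (homB _ (groupVr Hg))) /= invgK.
by rewrite /char_poly /char_poly_mx -map_trmx -[X in X - _]tr_scalar_mx -linearB det_tr.
Qed.

Lemma self_dual_mxtrace (H : {group gT}) n (r : mx_representation F H n) theta :
    brauer_of r theta -> self_dual theta ->
  {in H, forall g, \tr (r g^-1%g) = \tr (r g)}.
Proof.
move=> th sd g Hg; rewrite !(brauer_of_mxtrace th) ?groupV // consttV.
by rewrite {1}sd ffunE invgK.
Qed.

Lemma brauer_of_conj (N : {group gT}) n (r : mx_representation F N n) theta x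
    (nNx : x \in 'N(N)) :
  brauer_of r theta -> brauer_of (conj_repr r nNx) (conj_char theta x).
Proof.
move=> th g; rewrite ffunE; move: (th (g ^ x^-1)%g).
by rewrite memJ_norm ?groupV // p_eltJ orderJ.
Qed.

Lemma brauer_of_res (H N : {group gT}) n (r : mx_representation F H n) theta
    (sNH : N \subset H) :
  brauer_of r theta -> brauer_of (subg_repr r sNH) (res_char N theta).
Proof.
move=> th g; rewrite ffunE; move: (th g).
by case: (boolP (g \in N)) => //= Ng; rewrite (subsetP sNH).
Qed.

Lemma brauer_of_sum (H : {group gT}) n (r : mx_representation F H n) theta
    (I : eqType) (s : seq I) (dims : I -> nat)
    (rs : forall i, mx_representation F H (dims i)) (phis : I -> {ffun gT -> R}) :
    H \subset G -> brauer_of r theta ->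
    (forall i, i \in s -> brauer_of (rs i) (phis i)) ->
    {in H, forall g, char_poly (r g) = \prod_(i <- s) char_poly (rs i g)} ->
  theta = \sum_(i <- s) phis i.
Proof.
move=> sHG th ph cp; apply: (brauer_of_uniq sHG th) => g; rewrite sum_ffunE.
case: ifP => [/andP[Hg p'g] | out].
  by rewrite cp //; apply: brauer_lift_prod => i /ph phi; apply: brauer_of_lift.
by rewrite big_seq big1 // => i /ph phi; rewrite (brauer_of_out phi) ?out.
Qed.

(* The trace of [c] on any module affording [theta].                          *)
Definition brauer_functional (N : {group gT}) (c : gT -> F) (theta : {ffun gT -> R}) : F :=
  \sum_(h in N) c h * red (theta h.`_p^').

Lemma brauer_functionalE (N : {group gT}) n (r : mx_representation F N n) theta c :
  brauer_of r theta -> brauer_functional N c theta = \tr (repr_lin r c).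
Proof.
move=> th; rewrite mxtrace_repr_lin; apply: eq_bigr => h Nh.
by rewrite (brauer_of_mxtrace th).
Qed.

Lemma brauer_functional_sum (N : {group gT}) c (s : seq {ffun gT -> R}) :
  brauer_functional N c (\sum_(chi <- s) chi) = \sum_(chi <- s) brauer_functional N c chi.
Proof.
rewrite /brauer_functional exchange_big; apply: eq_bigr => h _.
by rewrite sum_ffunE rmorph_sum mulr_sumr.
Qed.

(** The modules are only known to exist, one for each index; the proof collects witnesses in a list.
    [Q] keeps track of what is known about each of them. *)
Lemma not_rsim_separate_fam (N : {group gT}) n (r : mx_representation F N n)
    (I : eqType) (s : seq I) (Q : I -> any_repr F N -> Prop) A :
    mx_absolutely_irreducible r ->
    {in s, forall i, exists x, [/\ mx_absolutely_irreducible (packed_repr x),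
       ~ mx_rsim r (packed_repr x) & Q i x]} ->
  exists c, repr_lin r c = A /\
    {in s, forall i, exists2 x, Q i x & repr_lin (packed_repr x) c = 0}.
Proof.
move=> absr sepQ.
have [L nL QL]: exists2 L,
    List.Forall (fun x => mx_absolutely_irreducible (packed_repr x) /\
                          ~ mx_rsim r (packed_repr x)) L &
    forall c, List.Forall (fun x => repr_lin (packed_repr x) c = 0) L ->
    {in s, forall i, exists2 x, Q i x & repr_lin (packed_repr x) c = 0}.
  elim: s sepQ => [|i s IHs] sepQ; first by exists [::].
  have [L nL QL] := IHs (fun j sj => sepQ j (mem_behead (s := i :: s) sj)).
  have [x [absx nx Qx]] := sepQ i (mem_head i s).
  exists (x :: L); first by constructor.
  move=> c /List.Forall_cons_iff[x0 L0] j; rewrite inE => /predU1P[-> | sj].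
    by exists x.
  exact: QL.
have [c [cA c0]] := not_rsim_separate_seq A absr nL.
by exists c; split=> //; apply: QL.
Qed.

(** Some group algebra element acts as a rank-one idempotent on the module of [phi] and as 0 on
    those of the other terms; its trace counts the occurrences of [phi]. Equality in [F] is enough
    to compare parities when [p] is 2. *)
Lemma count_irr_brauer (N : {group gT}) (phi : {ffun gT -> R}) s1 s2 :
    N \subset G -> irr_brauer_char p red N phi ->
    {in s1 ++ s2, forall chi, irr_brauer_char p red N chi} ->
    \sum_(chi <- s1) chi = \sum_(chi <- s2) chi ->
  (count_mem phi s1)%:R = (count_mem phi s2)%:R :> F.
Proof.
move=> sNG [n [r [irr phi_r]]] irr_s eq_sum.
have absr := irr_abs_irr sNG irr; have n_gt0: (0 < n)%N by case/andP: absr.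
pose i0 := Ordinal n_gt0.
pose s := [seq chi <- s1 ++ s2 | chi != phi].
have [|c [c1 c0]] := @not_rsim_separate_fam N n r _ s
   (fun chi x => brauer_of (packed_repr x) chi) (delta_mx i0 i0) absr.
  move=> chi; rewrite mem_filter => /andP[chi'phi /irr_s[m [rc [irrc chi_rc]]]].
  exists (PackRepr rc); split=> //; first exact: irr_abs_irr.
  move=> sim; case/eqP: chi'phi; apply: (brauer_of_uniq sNG chi_rc).
  exact: brauer_of_char_poly (char_poly_rsim sim) phi_r.
have tr1: brauer_functional N c phi = 1.
  rewrite (brauer_functionalE c phi_r) c1 /mxtrace (bigD1 i0) //= mxE eqxx big1 ?addr0 //.
  by move=> i i'0; rewrite mxE (negPf i'0).
have count_s t: {subset t <= s1 ++ s2} ->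
    brauer_functional N c (\sum_(chi <- t) chi) = (count_mem phi t)%:R.
  move=> sub; rewrite brauer_functional_sum -sum1_count natr_sum [RHS]big_mkcond /=.
  apply: eq_big_seq => chi /sub s_chi; case: eqP => [-> // | /eqP chi'phi].
  have [|x chi_x x0] := c0 chi; first by rewrite mem_filter chi'phi.
  by rewrite (brauer_functionalE c chi_x) x0 linear0.
rewrite -count_s => [|chi s1chi]; last by rewrite mem_cat s1chi.
by rewrite eq_sum count_s // => chi s2chi; rewrite mem_cat s2chi orbT.
Qed.

End BrauerCharactersOfRepresentations.

(** * The self-dual extension *)

Section SelfDualExtension.

Variables (R : idomainType) (F : fieldType) (red : {rmorphism R -> F}).
Hypothesis hsys : modular_system 2 red.
Variables (gT : finGroupType) (G N : {group gT}).
Hypotheses (hK : splits_subgroups {fraction R} G) (hF : splits_subgroups F G).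
Hypothesis nsNG : N <| G.
Variables (phi : {ffun gT -> R}) (n : nat) (r : mx_representation F N n).
Hypotheses (irr_r : mx_irreducible r) (phi_r : brauer_char_of 2 red r phi).

Local Notation T := (char_stab_group G phi).
Let pcharF : 2 \in [pchar F] := modsys_pchar hsys.
Let sNG : N \subset G := normal_sub nsNG.
Let abs_r : mx_absolutely_irreducible r := irr_abs_irr hF sNG irr_r.
Let n_gt0 : (0 < n)%N. Proof. by case/andP: abs_r. Qed.

Lemma char_stab_sub : T \subset G.
Proof. by apply/subsetP=> t; rewrite inE => /andP[]. Qed.

Lemma char_stab_norm t : t \in T -> t \in 'N(N).
Proof. by move/(subsetP char_stab_sub); apply: (subsetP (normal_norm nsNG)). Qed.

Lemma sub_char_stab : N \subset T.
Proof.
apply/subsetP=> x Nx; rewrite inE (subsetP sNG) //=; apply/eqP/esym.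
have nNx := subsetP (normG N) x Nx.
apply: (brauer_of_uniq hsys hK sNG phi_r).
apply: brauer_of_char_poly (brauer_of_conj nNx phi_r) => g Ng /=.
apply: (char_poly_intertwine (P := r x)); first exact: repr_mx_unit.
by rewrite -!repr_mxM ?groupJ ?groupV // conjgE invgK !mulgA mulgKV.
Qed.

Lemma conj_stab_rsim t (nNt : t \in 'N(N)) :
  t \in T -> mx_rsim (conj_repr r nNt) r.
Proof.
rewrite inE => /andP[_ /eqP phi_t].
apply: (brauer_of_rsim hsys hF sNG _ irr_r (theta := phi)) => //.
  exact: conj_repr_irr.
by rewrite -phi_t; apply: brauer_of_conj.
Qed.

Lemma conj_rsim_stab t (nNt : t \in 'N(N)) :
  t \in G -> mx_rsim r (conj_repr r nNt) -> t \in T.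
Proof.
move=> Gt sim; rewrite inE Gt /=; apply/eqP/esym.
apply: (brauer_of_uniq hsys hK sNG (r := conj_repr r nNt)).
  by apply: brauer_of_char_poly phi_r; apply: char_poly_rsim.
exact: brauer_of_conj.
Qed.

Variable B : 'M[F]_n.
Hypotheses (uB : B \in unitmx) (iB : invariant_form r B).

Let nzB : B != 0.
Proof. by apply: contraTneq uB => ->; rewrite -row_free_unit /row_free mxrank0 eq_sym -lt0n. Qed.

Definition twist_hom t (X : 'M[F]_n) :=
  {in N, forall h, r (h ^ t^-1)%g *m X = X *m r h}.

Lemma twist_hom_exists t : t \in T -> exists2 X, X \in unitmx & twist_hom t X.
Proof.
move=> Tt; have [X _ freeX homX] := conj_stab_rsim (char_stab_norm Tt) Tt.
by exists X; rewrite -?row_free_unit.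
Qed.

Lemma twist_hom_scale t X Y :
  t \in T -> X \in unitmx -> twist_hom t X -> twist_hom t Y -> exists a, Y = a *: X.
Proof.
move=> Tt uX homX homY.
apply: (abs_irr_hom_scale (r := conj_repr r (char_stab_norm Tt)) (s := r)) => //.
by rewrite (mx_rsim_abs_irr (conj_stab_rsim _ Tt)).
Qed.

Lemma twist_hom_multiplier t X :
  t \in T -> twist_hom t X -> exists c, X *m B *m X^T = c *: B.
Proof.
move=> Tt homX; apply: (invariant_form_scale abs_r uB iB) => g Ng.
have Ngt: (g ^ t)%g \in N by rewrite memJ_norm ?char_stab_norm.
have rX: r g *m X = X *m r (g ^ t)%g by rewrite -homX // conjgK.
by rewrite !mulmxA rX -[_ *m X^T *m _]mulmxA -trmx_mul rX trmx_mul !mulmxA -[X *m _ *m _ *m _]mulmxA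
  -[X *m _ *m _]mulmxA [r _ *m _ in LHS]mulmxA iB.
Qed.

Lemma iter_Frobenius m : exists f : {rmorphism F -> F}, forall x, f x = x ^+ (2 ^ m).
Proof.
elim: m => [|m [f fE]]; first by exists idfun => x; rewrite expr1.
exists (pFrobenius_aut pcharF \o f)=> x /=.
by rewrite pFrobenius_autE fE -exprM expnSr.
Qed.

(* A power of the Frobenius map fixes the character [phi], so [r] is similar  *)
(* to its own twist, whose entries are squares even when [F] is imperfect.    *)
Lemma Frobenius_twist_rsim :
  exists2 m, (0 < m)%N & forall f : {rmorphism F -> F},
    (forall x, f x = x ^+ (2 ^ m)) -> mx_rsim (map_repr f r) r.
Proof.
(* By Euler's theorem [2 ^ totient k] is 1 modulo [k], so this power of Frobenius fixes every root
   of unity of odd order dividing [#|N|]. *)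
pose k := (#|N|`_2^')%N; exists (totient k); first by rewrite totient_gt0 part_gt0.
move=> f fE.
have irr_f: mx_absolutely_irreducible (map_repr f r) by rewrite map_mx_abs_irr.
apply: rsim_mxtrace => // g Ng; rewrite map_reprE trace_map_mx.
rewrite (brauer_of_mxtrace hsys phi_r Ng) fE.
have Ng': (constt g 2%N^') \in N by apply: groupX.
have [s [s1 _ ->]] := brauer_of_lift phi_r Ng' (p_elt_constt _ _).
rewrite -fE !rmorph_sum; apply: eq_big_seq => z sz /=; rewrite fE -rmorphXn.
congr (red _); have k_gt1: (2 ^ totient k = 1 %[mod #[(constt g 2%N^')%g]])%N.
  have: (#[(constt g 2%N^')%g] %| k)%N.
    rewrite order_constt; apply: partn_dvd; rewrite ?cardG_gt0 //.
    exact: order_dvdG.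
  move=> dvd_k; rewrite -(modn_dvdm _ dvd_k) Euler_exp_totient ?modn_dvdm //.
  rewrite coprime2n; have := part_pnat 2%N^' #|N|; rewrite p'natE // dvdn2.
  by rewrite negbK.
have {2}<-: z ^+ 1 = z by rewrite expr1.
by rewrite -(expr_mod _ (s1 z sz)) k_gt1 expr_mod ?s1.
Qed.

(** Let [f] be the Frobenius power fixing [r] up to the similarity [P]. Transporting [X] and [B] by
    [f] and then [P] gives a twisting operator [a *: X] and a form [b *: B]. Comparing multipliers
    yields [a ^+ 2 * c = c ^+ (2 ^ m)], whose right side is a square because [m] is positive. [F]
    need not be perfect. *)
Lemma twist_hom_multiplier_square t X c :
    t \in T -> X \in unitmx -> twist_hom t X -> X *m B *m X^T = c *: B ->
  exists2 e, e != 0 & c = e ^+ 2.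
Proof.
move=> Tt uX homX defc.
have [m m_gt0 frob] := Frobenius_twist_rsim.
have [f fE] := iter_Frobenius m.
have [P _ freeP homP] := frob f fE; have uP: P \in unitmx by rewrite -row_free_unit.
pose Y := invmx P *m map_mx f X *m P; pose C := invmx P *m map_mx f B *m (invmx P)^T.
have homV g: g \in N -> r g *m invmx P = invmx P *m map_mx f (r g).
  move=> Ng; apply: (canLR (mulmxK uP)); rewrite -mulmxA [map_mx _ _ *m P]homP //.
  by rewrite mulKmx.
have nzc: c != 0.
  apply: contraNneq nzB => c0; rewrite c0 scale0r in defc.
  rewrite -(mulKmx uX B) -(mulmxK (_ : X^T \in unitmx) (X *m B)) ?unitmx_tr //.
  by rewrite defc mul0mx mulmx0.
have [a defY]: exists a, Y = a *: X.
  apply: (twist_hom_scale Tt uX homX) => h Nh.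
  rewrite /Y !mulmxA homV ?memJ_norm ?groupV ?char_stab_norm //.
  rewrite -[_ *m map_mx f _ *m map_mx f X]mulmxA -map_mxM homX // map_mxM -!mulmxA.
  by rewrite [map_mx _ _ *m P]homP.
have [b defC]: exists b, C = b *: B.
  apply: (invariant_form_scale abs_r uB iB) => g Ng.
  have invBf Q: map_mx f (r g) *m (map_mx f B *m ((map_mx f (r g))^T *m Q)) = map_mx f B *m Q.
    by rewrite map_trmx !mulmxA -!map_mxM iB.
  rewrite /C !mulmxA homV // -[_ *m _^T *m _]mulmxA -trmx_mul homV // trmx_mul.
  by rewrite -!mulmxA invBf.
have YCY: Y *m C *m Y^T = f c *: C.
  have multBf Q: map_mx f X *m (map_mx f B *m ((map_mx f X)^T *m Q)) = f c *: (map_mx f B *m Q).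
    by rewrite map_trmx !mulmxA -!map_mxM defc map_mxZ scalemxAl.
  have PVT Q: (invmx P)^T *m (P^T *m Q) = Q :> 'M_n.
    by rewrite mulmxA -trmx_mul mulmxV // trmx1 mul1mx.
  by rewrite /Y /C !trmx_mul -!mulmxA mulKVmx // PVT multBf -scalemxAr.
have nzb: b != 0.
  apply: contraTneq (_ : C \in unitmx) => [b0|].
    by rewrite defC b0 scale0r -row_free_unit /row_free mxrank0 eq_sym -lt0n.
  by rewrite !unitmx_mul unitmx_tr !unitmx_inv uP map_unitmx uB.
have defa: a ^+ 2 * c = f c.
  have := YCY; rewrite defY defC [(a *: X)^T]linearZ /= -!(scalemxAl, scalemxAr) defc !scalerA.
  move/eqP; rewrite -subr_eq0 -scalerBl scaler_eq0 (negPf nzB) orbF subr_eq0.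
  by move=> /eqP E; apply: (mulIf nzb); rewrite -E mulrAC.
have nza: a != 0.
  by apply: contraNneq nzc => a0; rewrite -(fmorph_eq0 f) -defa a0 expr0n mul0r.
exists (c ^+ (2 ^ m.-1) / a); first by rewrite mulf_neq0 ?invr_eq0 ?expf_neq0.
rewrite expr_div_n -exprM -expnSr prednK // -fE -defa mulrC mulKf //.
by rewrite expf_neq0.
Qed.

Definition isometric_twist t X :=
  [/\ X \in unitmx, twist_hom t X & X *m B *m X^T = B].

Lemma isometric_twist_exists t : t \in T -> exists X, isometric_twist t X.
Proof.
move=> Tt; have [X uX homX] := twist_hom_exists Tt.
have [c defc] := twist_hom_multiplier Tt homX.
have [e nze defe] := twist_hom_multiplier_square Tt uX homX defc.
exists (e^-1 *: X); split.
- by rewrite unitmxZ ?unitfE ?invr_eq0.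
- by move=> h Nh; rewrite -scalemxAl -scalemxAr homX.
rewrite linearZ /= -!scalemxAl -scalemxAr defc !scalerA defe.
by rewrite -expr2 -exprMn mulVf // expr1n scale1r.
Qed.

Lemma isometric_twist_uniq t X Y :
  t \in T -> isometric_twist t X -> isometric_twist t Y -> X = Y.
Proof.
move=> Tt [uX homX XB] [_ homY YB].
have [a defY] := twist_hom_scale Tt uX homX homY.
suffices a1: a = 1 by rewrite defY a1 scale1r.
apply: (sqr_inj_pchar2 pcharF); apply/eqP; rewrite expr1n -subr_eq0.
have := YB; rewrite defY linearZ /= -!scalemxAl -scalemxAr XB scalerA -expr2.
move/eqP; rewrite -{2}[B]scale1r -subr_eq0 -scalerBl scaler_eq0.
by rewrite (negPf nzB) orbF.
Qed.

Lemma isometric_twistM s t X Y :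
    s \in T -> t \in T -> isometric_twist s X -> isometric_twist t Y ->
  isometric_twist (s * t)%g (X *m Y).
Proof.
move=> Ts Tt [uX homX XB] [uY homY YB]; split; first by rewrite unitmx_mul uX.
  move=> h Nh; rewrite invMg conjgM mulmxA homX ?memJ_norm ?groupV ?char_stab_norm //.
  by rewrite -mulmxA homY // mulmxA.
by rewrite trmx_mul -!mulmxA [B *m _]mulmxA [Y *m _]mulmxA [Y *m (_ *m _)]mulmxA YB mulmxA XB.
Qed.

Lemma isometric_twist_sub h : h \in N -> isometric_twist h (r h).
Proof.
move=> Nh; split; [exact: repr_mx_unit | | exact: iB].
by move=> g Ng; rewrite -!repr_mxM ?groupJ ?groupV // conjgE invgK !mulgA mulgKV.
Qed.

(** Isometric twists are closed under products and unique for each [t], so choosing them gives a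
    homomorphism with no cocycle to remove; the same uniqueness makes it agree with [r] on [N]. *)
Lemma self_dual_extension_exists :
  exists rT : mx_representation F T n,
    {in N, rT =1 r} /\ {in T, forall t, isometric_twist t (rT t)}.
Proof.
have /fin_all_exists[E defE] t: exists X, t \in T -> isometric_twist t X.
  have [Tt | notTt] := boolP (t \in T); last by exists 0.
  by have [X] := isometric_twist_exists Tt; exists X.
have ErN: {in N, E =1 r}.
  move=> h Nh; have Th := subsetP sub_char_stab h Nh.
  exact: isometric_twist_uniq Th (defE h Th) (isometric_twist_sub Nh).
have reprE: mx_repr T E.
  split=> [|s t Ts Tt]; first by rewrite ErN ?group1 ?repr_mx1.
  apply: (isometric_twist_uniq (t := (s * t)%g)); rewrite ?groupM //.
    by apply: defE; rewrite groupM.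
  exact: isometric_twistM (defE s Ts) (defE t Tt).
by exists (MxRepresentation reprE).
Qed.

(** A module [s] affording [psi'] restricts to a copy of [r] through some [P], and [P] carries the
    form of [s] to a nonzero multiple of [B]. So [P *m s t *m invmx P] is an isometric twist and
    must equal [rT t]. *)
Lemma self_dual_extension_uniq (rT : mx_representation F T n) psi psi' :
    {in T, forall t, isometric_twist t (rT t)} ->
    brauer_char_of 2 red rT psi -> brauer_char 2 red T psi' ->
    res_char N psi' = phi -> self_dual psi' ->
  psi = psi'.
Proof.
move=> rT_isom psi_rT [m [s psi'_s]] res_psi' sd_psi'.
have sTG := char_stab_sub.
have eq_mn: m = n.
  apply: (brauer_of_dim hsys psi'_s phi_r).
  by rewrite -res_psi' ffunE group1.
subst m; pose sN := subg_repr s sub_char_stab.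
have phi_sN: brauer_char_of 2 red sN phi by rewrite -res_psi'; apply: brauer_of_res.
(* The trace of [s] on [N] is that of [r], so [r] has odd multiplicity among  *)
(* the composition factors of [sN], and already has full dimension.          *)
have irr_sN: mx_irreducible sN.
  apply: NNPP => red_sN.
  have [L [irrL _ /(_ red_sN) ltL trL]] := composition_mxtrace sN.
  pose i0 := Ordinal n_gt0.
  have [|c [c1 c0]] := not_rsim_separate_seq (delta_mx i0 i0) abs_r (s := L).
    elim: {trL} irrL ltL => [|x L' irrx _ IHL] ltL; first by constructor.
    have /List.Forall_cons_iff[ltx ltL'] := ltL.
    constructor; last exact: IHL.
    split; first exact: (irr_abs_irr hF sNG irrx).
    by move/mxrank_rsim=> eq_n; rewrite -eq_n ltnn in ltx.
  have: \tr (repr_lin r c) = 0.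
    rewrite mxtrace_repr_lin (eq_bigr (fun h => \sum_(x <- L) c h * \tr (packed_repr x h))).
      rewrite exchange_big /=.
      elim: {irrL ltL trL} c0 => [|x L' x0 _ IHL]; first by rewrite big_nil.
      by rewrite big_cons IHL -mxtrace_repr_lin x0 linear0 addr0.
    move=> h Nh; rewrite -mulr_sumr -trL // (brauer_of_mxtrace hsys phi_r) //.
    by rewrite (brauer_of_mxtrace hsys phi_sN).
  rewrite c1 /mxtrace (bigD1 i0) //= mxE eqxx big1 ?addr0 => [/eqP|i i'0].
    by rewrite oner_eq0.
  by rewrite mxE (negPf i'0).
have [P _ freeP homP] := brauer_of_rsim hsys hF sNG irr_r irr_sN phi_r phi_sN.
have uP: P \in unitmx by rewrite -row_free_unit.
have abs_s: mx_absolutely_irreducible s.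
  by apply: (irr_abs_irr hF sTG); apply: subg_mx_irr irr_sN.
have [C uC iC] := self_dual_invariant_form abs_s (self_dual_mxtrace hsys psi'_s sd_psi').
have iCQ t (Q : 'M_n) : t \in T -> s t *m (C *m ((s t)^T *m Q)) = C *m Q.
  by move=> Tt; rewrite !mulmxA iC.
have [a defC]: exists a, P *m C *m P^T = a *: B.
  apply: (invariant_form_scale abs_r uB iB) => h Nh.
  rewrite !mulmxA homP // -[_ *m P^T *m _]mulmxA -trmx_mul homP // trmx_mul.
  by rewrite -!mulmxA iCQ // (subsetP sub_char_stab).
have nza: a != 0.
  apply: contraTneq (_ : P *m C *m P^T \in unitmx) => [a0|].
    by rewrite defC a0 scale0r -row_free_unit /row_free mxrank0 eq_sym -lt0n.
  by rewrite !unitmx_mul unitmx_tr uP uC.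
suffices eq_rT: {in T, forall t, rT t *m P = P *m s t}.
  symmetry; apply: (brauer_of_uniq hsys hK sTG psi'_s).
  apply: brauer_of_char_poly psi_rT => t Tt.
  exact: char_poly_intertwine uP (eq_rT t Tt).
move=> t Tt; apply: (canLR (mulmxKV uP)).
apply: (isometric_twist_uniq Tt (rT_isom t Tt)); split.
- by rewrite !unitmx_mul unitmx_inv uP repr_mx_unit.
- move=> h Nh; have Th := subsetP sub_char_stab h Nh.
  have Nht: (h ^ t^-1)%g \in N by rewrite memJ_norm ?groupV ?char_stab_norm.
  have ->: r h = P *m s h *m invmx P by apply: (canRL (mulmxK uP)); apply: homP.
  rewrite !mulmxA mulmxKV // [r _ *m P]homP //= -!mulmxA; congr (_ *m _).
  rewrite !mulmxA; congr (_ *m _); rewrite -!repr_mxM ?groupJ ?groupV //.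
  by rewrite conjgE invgK !mulgA mulgKV.
apply: (scalerI nza); rewrite scalemxAl scalemxAr -defC !trmx_mul.
have PVT Q: P^T *m ((invmx P)^T *m Q) = Q :> 'M_n.
  by rewrite mulmxA -trmx_mul mulVmx // trmx1 mul1mx.
by rewrite -!mulmxA mulKmx // PVT iCQ.
Qed.

End SelfDualExtension.

(** * Alternating matrices of odd size in characteristic 2 *)

Section AlternatingDeterminant.

Variable F : fieldType.
Hypothesis pcharF : 2 \in [pchar F].

(** Each pair of indices swapped by [sigma] contributes the same term twice. The ordering by
    [enum_rank] selects one index of each pair. *)
Lemma sum_involution_pchar2 (I : finType) (P : pred I) (sigma : I -> I) (t : I -> F) :
    involutive sigma -> (forall i, P i -> P (sigma i) && (sigma i != i)) ->
    (forall i, t (sigma i) = t i) ->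
  \sum_(i | P i) t i = 0.
Proof.
move=> sigmaK Psigma t_sigma.
rewrite (bigID (fun i => enum_rank i < enum_rank (sigma i))%N) /=.
rewrite [X in _ + X](reindex_inj (can_inj sigmaK)) /=.
rewrite [X in _ + X](eq_big (fun i => P i && (enum_rank i < enum_rank (sigma i))%N) t).
- by rewrite addrr_pchar2.
- move=> i; rewrite sigmaK -leqNgt; apply/andP/andP=> -[Pi le_i].
    have /andP[] := Psigma _ Pi; rewrite sigmaK => -> /negP ne_i.
    split=> //; rewrite ltn_neqAle le_i andbT; apply/negP=> /eqP/val_inj/enum_rank_inj.
    by move/eqP.
  by have /andP[-> _] := Psigma _ Pi; split=> //; apply: ltnW.
- by move=> i _; apply: t_sigma.
Qed.

(* Pairing a permutation with its inverse leaves only the involutions in the  *)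
(* Leibniz formula, and an involution of an odd set has a fixed point.        *)
Lemma det_alternating_odd n (M : 'M[F]_n) :
  odd n -> M^T = M -> (forall i, M i i = 0) -> \det M = 0.
Proof.
move=> odd_n symM diagM; rewrite /determinant.
rewrite (bigID (fun s : 'S_n => s^-1%g == s)) /= [X in X + _]big1 ?add0r.
  apply: (sum_involution_pchar2 (sigma := @invg _)) => [|s s'V|s]; first exact: invgK.
    by rewrite invgK eq_sym s'V.
  rewrite odd_permV; congr (_ * _); rewrite (reindex_inj (@perm_inj _ s)) /=.
  by apply: eq_bigr => i _; rewrite permK -[in LHS]symM mxE.
move=> s /eqP sV.
have [i /eqP si]: exists i, s i == i.
  apply/existsP; apply: contraLR odd_n => /existsPn/= ns.
  rewrite -dvdn2 (dvdn_pcharf pcharF) -[n]card_ord -sum1_card natr_sum.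
  apply/eqP/(sum_involution_pchar2 (sigma := s)) => // [i|i _]; last by rewrite ns.
  by rewrite -{1}sV permK.
by rewrite (bigD1 i) //= si diagM mul0r mulr0.
Qed.

End AlternatingDeterminant.

(** * Self-dual modules of odd multiplicity *)

Section CliffordRestriction.

Variables (R : idomainType) (F : fieldType) (red : {rmorphism R -> F}).
Hypothesis hsys : modular_system 2 red.
Variables (gT : finGroupType) (G N : {group gT}).
Hypotheses (hK : splits_subgroups {fraction R} G) (hF : splits_subgroups F G).
Hypothesis nsNG : N <| G.
Local Notation brauer_of := (brauer_char_of 2 red).

Let sNG : N \subset G := normal_sub nsNG.
Let nNG x : x \in G -> x \in 'N(N) := subsetP (normal_norm nsNG) x.

Lemma conj_irr_brauer phi x :
  x \in G -> irr_brauer_char 2 red N phi -> irr_brauer_char 2 red N (conj_char phi x).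
Proof.
move=> Gx [n [r [irr phi_r]]]; exists n, (conj_repr r (nNG Gx)).
by split; [apply: conj_repr_irr | apply: brauer_of_conj].
Qed.

Lemma hom_conj n d (r : mx_representation F N n) (V : mx_representation F G d)
    (f : 'M_(n, d)) x h :
    {in N, forall h, r h *m f = f *m V h} -> x \in G -> h \in N ->
  r (h ^ x^-1)%g *m (f *m V x) = f *m V x *m V h.
Proof.
move=> homf Gx Nh; have Gh := subsetP sNG h Nh.
rewrite mulmxA homf ?memJ_norm ?groupV ?nNG // -!mulmxA -!repr_mxM ?groupJ ?groupV //.
by rewrite conjgE invgK !mulgA mulgKV.
Qed.

Lemma Clifford_restriction n d (r : mx_representation F N n)
    (V : mx_representation F G d) (f : 'M_(n, d)) phi theta (X : {set gT}) :
    {in N, forall h, r h *m f = f *m V h} ->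
    brauer_of r phi -> brauer_of V theta ->
    X \subset G -> (\sum_(x in X) <<f *m V x>> :=: 1%:M)%MS -> d = (#|X| * n)%N ->
  res_char N theta = \sum_(chi <- [seq conj_char phi x | x <- enum X]) chi.
Proof.
move=> homf phi_r theta_V sXG sumX dimX; rewrite big_map.
(* [conj_repr] needs a proof that its element normalizes [N]; the default 1 makes the family of
   representations total. *)
pose e x := if x \in G then x else 1%g.
have Ge x: e x \in G by rewrite /e; case: ifP.
have eX: {in X, forall x, e x = x} by move=> x /(subsetP sXG) Gx; rewrite /e Gx.
apply: (brauer_of_sum hsys hK sNG (brauer_of_res sNG theta_V)
          (rs := fun x => conj_repr r (nNG (Ge x)))).
  move=> x; rewrite mem_enum => Xx; have ->: conj_char phi x = conj_char phi (e x) by rewrite eX.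
  exact: brauer_of_conj.
move=> h Nh /=; apply: (char_poly_dsum (Q := fun x => f *m V (e x)) (k := n)).
- by move=> x; rewrite hom_conj.
- rewrite big_enum /=; apply: eqmx_trans sumX; apply: eqmx_sums => x Xx.
  by rewrite eX.
- by rewrite -cardE.
Qed.

Lemma count_conj (phi : {ffun gT -> R}) (X : {set gT}) :
    X \subset G ->
  count_mem phi [seq conj_char phi x | x <- enum X] = #|X :&: char_stab_group G phi|.
Proof.
move=> sXG; rewrite count_map -size_filter cardE; apply: perm_size.
apply: uniq_perm => [||x]; [exact/filter_uniq/enum_uniq | exact: enum_uniq |].
rewrite mem_filter !mem_enum !inE /= andbC.
by case: (boolP (x \in X)) => //= /(subsetP sXG)->.
Qed.

End CliffordRestriction.

Section OddMultiplicity.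

Variables (R : idomainType) (F : fieldType) (red : {rmorphism R -> F}).
Hypothesis hsys : modular_system 2 red.
Variables (gT : finGroupType) (G N : {group gT}).
Hypotheses (hK : splits_subgroups {fraction R} G) (hF : splits_subgroups F G).
Hypothesis nsNG : N <| G.
Variables (phi : {ffun gT -> R}) (n : nat) (r : mx_representation F N n).
Hypotheses (irr_r : mx_irreducible r) (phi_r : brauer_char_of 2 red r phi).

Local Notation brauer_of := (brauer_char_of 2 red).
Local Notation T := (char_stab_group G phi).
Let pcharF : 2 \in [pchar F] := modsys_pchar hsys.
Let sNG : N \subset G := normal_sub nsNG.
Let nNG x : x \in G -> x \in 'N(N) := subsetP (normal_norm nsNG) x.
Let abs_r : mx_absolutely_irreducible r := irr_abs_irr hF sNG irr_r.
Let n_gt0 : (0 < n)%N. Proof. by case/andP: abs_r. Qed.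
Let sTG : T \subset G := char_stab_sub G phi.
Let sNT : N \subset T := sub_char_stab hsys hK nsNG phi_r.

Variable B : 'M[F]_n.
Hypothesis uB : B \in unitmx.
Variable rT : mx_representation F T n.
Hypotheses (rT_N : {in N, rT =1 r}) (iBT : invariant_form rT B).

Let iB : invariant_form r B.
Proof. by move=> h Nh; rewrite -!rT_N // iBT ?(subsetP sNT). Qed.

Let nzB : B != 0.
Proof. by apply: contraTneq uB => ->; rewrite -row_free_unit /row_free mxrank0 eq_sym -lt0n. Qed.

Definition stab_hom d (V : mx_representation F G d) (f : 'M_(n, d)) :=
  {in T, forall t, rT t *m f = f *m V t}.

Definition sub_hom d (V : mx_representation F G d) (f : 'M_(n, d)) :=
  {in N, forall h, r h *m f = f *m V h}.

Lemma stab_hom_sub d (V : mx_representation F G d) f : stab_hom V f -> sub_hom V f.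
Proof. by move=> homf h Nh; rewrite -rT_N // homf ?(subsetP sNT). Qed.

(* On an irreducible [V] lying over [phi], [eps] acts as the projection onto   *)
(* the [phi]-isotypic component, which the elements of [G] outside [T] move   *)
(* to other components; hence only the part of [c] supported on [T] survives  *)
(* in [stab_hom_project].                                                    *)
Lemma stab_separate : exists eps : gT -> F,
  repr_lin r eps = 1%:M /\
  {in G, forall y, y \notin T -> \sum_(h in N) eps h *: r (h ^ y^-1)%g = 0}.
Proof.
have [|eps [eps1 eps0]] := @not_rsim_separate_fam _ _ N n r _ (enum (G :\: T))
    (fun y x => exists nNy : y \in 'N(N), x = PackRepr (conj_repr r nNy)) 1%:M abs_r.
  move=> y; rewrite mem_enum inE => /andP[notTy Gy].
  exists (PackRepr (conj_repr r (nNG Gy))); split; last by exists (nNG Gy).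
    by apply: (irr_abs_irr hF sNG); apply: conj_repr_irr.
  by move=> sim; case/negP: notTy; apply: (conj_rsim_stab hsys hK nsNG phi_r Gy sim).
exists eps; split=> // y Gy notTy.
have [|x [nNy ->]] := eps0 y; last by [].
by rewrite mem_enum inE notTy.
Qed.

Lemma sub_hom_kill d (V : mx_representation F G d) f eps y :
    sub_hom V f -> y \in G -> \sum_(h in N) eps h *: r (h ^ y^-1)%g = 0 ->
  f *m V y *m repr_lin (subg_repr V sNG) eps = 0.
Proof.
move=> homf Gy eps0; rewrite /repr_lin mulmx_sumr.
transitivity ((\sum_(h in N) eps h *: r (h ^ y^-1)%g) *m (f *m V y)); last first.
  by rewrite eps0 mul0mx.
rewrite mulmx_suml; apply: eq_bigr => h Nh.
by rewrite -scalemxAr -scalemxAl (hom_conj nsNG homf).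
Qed.

(** After expanding [c] over [G], the terms outside [T] are killed by [eps], while those in [T] pass
    through [f], on whose image [eps] acts as 1. *)
Lemma stab_hom_project d (V : mx_representation F G d) f c eps :
    stab_hom V f -> repr_lin r eps = 1%:M ->
    {in G, forall y, y \notin T -> \sum_(h in N) eps h *: r (h ^ y^-1)%g = 0} ->
  f *m repr_lin V c *m repr_lin (subg_repr V sNG) eps = repr_lin rT c *m f.
Proof.
move=> homf eps1 eps0; set Ve := repr_lin (subg_repr V sNG) eps.
rewrite [repr_lin V c]/repr_lin [repr_lin rT c]/repr_lin [f *m _]mulmx_sumr !mulmx_suml.
rewrite (bigID (fun g => g \in T)) /= [X in _ + X]big1 ?addr0; last first.
  move=> g /andP[Gg notTg]; rewrite -scalemxAr -scalemxAl.
  by rewrite sub_hom_kill ?scaler0 ?eps0 //; apply: stab_hom_sub.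
apply: eq_big => [g | g /andP[Gg Tg]].
  by rewrite andbC; case: (boolP (g \in T)) => //= /(subsetP sTG).
rewrite -scalemxAr -!scalemxAl -homf // -mulmxA; congr (_ *: (_ *m _)).
rewrite /Ve -(repr_lin_hom (r1 := r)) ?eps1 ?mul1mx //.
by move=> h Nh; apply: stab_hom_sub.
Qed.

(** An element [c] acting as 1 on [V1] and as 0 on [V2] would, by [stab_hom_project], act as 1 on
    [rT] and yet annihilate [f2]. *)
Lemma stab_hom_rsim d1 d2 (V1 : mx_representation F G d1) (V2 : mx_representation F G d2)
    f1 f2 :
    mx_irreducible V1 -> mx_irreducible V2 -> stab_hom V1 f1 -> stab_hom V2 f2 ->
  f1 != 0 -> f2 != 0 -> mx_rsim V1 V2.
Proof.
move=> irr1 irr2 hom1 hom2 nz1 nz2; apply: NNPP => nsim.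
have [eps [eps1 eps0]] := stab_separate.
have abs1 := irr_abs_irr hF (subxx G) irr1; have abs2 := irr_abs_irr hF (subxx G) irr2.
have [c [c1 c2]] := not_rsim_separate abs1 abs2 nsim.
have proj1 := stab_hom_project c hom1 eps1 eps0.
have proj2 := stab_hom_project c hom2 eps1 eps0.
rewrite c2 mulmx0 mul0mx in proj2; rewrite c1 mulmx1 in proj1.
rewrite -(repr_lin_hom (r1 := r)) ?eps1 ?mul1mx in proj1; last exact: stab_hom_sub.
have free1 := irr_hom_free (rG := V1) irr_r (stab_hom_sub hom1) nz1.
have cT1: repr_lin rT c = 1%:M.
  by apply: (row_free_inj free1); rewrite /= -proj1 mul1mx.
by case/eqP: nz2; rewrite -[f2]mul1mx -cT1 -proj2.
Qed.

(** Otherwise some [c] acts as 1 on [V] and 0 on its dual, so [c] composed with inversion acts as 0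
    on [V]. By projection the two act on [rT] as 1 and 0, but the form [B] makes them adjoint to
    each other, so [B] would vanish. *)
Lemma stab_hom_self_dual d (V : mx_representation F G d) f theta :
    mx_irreducible V -> stab_hom V f -> f != 0 -> brauer_of V theta ->
  self_dual theta.
Proof.
move=> irrV homf nzf theta_V.
have absV := irr_abs_irr hF (subxx G) irrV.
suffices [C _ freeC homC]: mx_rsim V (dual_repr V).
  apply: (brauer_of_self_dual hsys hK (subxx G) theta_V (B := C)).
    by rewrite -row_free_unit.
  exact/invariant_formP.
apply: NNPP => nsim.
have [eps [eps1 eps0]] := stab_separate.
have [c [c1 c2]] := not_rsim_separate absV (dual_repr_abs_irr absV) nsim.
have free_f := irr_hom_free (rG := V) irr_r (stab_hom_sub homf) nzf.
have proj1 := stab_hom_project c homf eps1 eps0.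
have proj2 := stab_hom_project (fun g => c g^-1%g) homf eps1 eps0.
have c0: repr_lin V (fun g => c g^-1%g) = 0.
  apply: trmx_inj; rewrite trmx0 -c2 /repr_lin linear_sum (reindex_inj invg_inj) /=.
  by apply: eq_big => g; rewrite ?groupV // invgK linearZ.
rewrite c0 mulmx0 mul0mx in proj2; rewrite c1 mulmx1 in proj1.
rewrite -(repr_lin_hom (r1 := r)) ?eps1 ?mul1mx in proj1; last exact: stab_hom_sub.
have cT1: repr_lin rT c = 1%:M.
  by apply: (row_free_inj free_f); rewrite /= -proj1 mul1mx.
have cT0: repr_lin rT (fun g => c g^-1%g) = 0.
  by apply: (row_free_inj free_f); rewrite /= -proj2 mul0mx.
have: repr_lin rT c *m B = B *m (repr_lin rT (fun g => c g^-1%g))^T.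
  rewrite (repr_lin_hom c ((invariant_formP _ _).1 iBT)); congr (_ *m _).
  rewrite /repr_lin linear_sum [RHS](reindex_inj invg_inj) /=.
  by apply: eq_big => g; rewrite ?groupV // invgK linearZ.
by rewrite cT1 cT0 mul1mx trmx0 mulmx0 => B0; case/eqP: nzB.
Qed.

(** The image of a [T]-map is stable under [T], so two translates of it by elements of [T] coincide
    and a direct sum contains at most one. It contains at least one, since [eps] kills all the other
    translates but not [f]. *)
Lemma stab_hom_multiplicity d (V : mx_representation F G d) f theta :
    mx_irreducible V -> stab_hom V f -> f != 0 -> brauer_of V theta ->
  multiplicity 2 red N phi (res_char N theta) 1.
Proof.
move=> irrV homf nzf theta_V; have homN := stab_hom_sub homf.
have [X [sXG sumX dimX dxX]] := Clifford_hom_basis nsNG irrV irr_r homN nzf.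
exists [seq conj_char phi x | x <- enum X]; split.
- move=> chi /mapP[x]; rewrite mem_enum => /(subsetP sXG) Gx ->.
  by apply: (conj_irr_brauer nsNG Gx); exists n, r.
- exact: (Clifford_restriction hsys hK nsNG homN phi_r theta_V).
rewrite (count_conj phi sXG); have [eps [eps1 eps0]] := stab_separate.
have [x]: exists x, x \in X :&: T.
  apply/set0Pn; apply: contraNneq nzf => X0.
  rewrite -[f]mul1mx -eps1 (repr_lin_hom eps homN (r2 := subg_repr V sNG)).
  suffices: (1%:M <= kermx (repr_lin (subg_repr V sNG) eps))%MS.
    by move/sub_kermxP; rewrite mul1mx => ->; rewrite mulmx0.
  rewrite -sumX; apply/sumsmx_subP=> x Xx; rewrite genmxE; apply/sub_kermxP.
  have Gx := subsetP sXG x Xx; apply: sub_hom_kill => //; apply: eps0 => //.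
  by apply: contra_eqN X0 => Tx; apply/set0Pn; exists x; rewrite inE Xx.
rewrite inE => /andP[Xx Tx]; apply/eqP/cards1P; exists x.
apply/setP=> y; rewrite !inE; apply/idP/eqP=> [/andP[Xy /= Ty] | ->]; last first.
  by rewrite Xx /=; move: Tx; rewrite inE.
have {}Ty : y \in T by rewrite inE.
apply/eqP/negPn/negP=> y'x; case/negP: nzf.
have le_f z: z \in T -> (f <= <<f *m V z>>)%MS.
  move=> Tz; have {1}->: f = rT z^-1%g *m (rT z *m f).
    by rewrite mulmxA -repr_mxM ?groupV // mulVg repr_mx1 mul1mx.
  by rewrite genmxE -homf // submxMl.
rewrite -submx0 -(dxX x Xx) sub_capmx le_f //=.
by apply: (sumsmx_sup y); rewrite ?Xy // le_f.
Qed.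

Let symB : B^T = B.
Proof. exact: invariant_form_sym pcharF abs_r uB iB. Qed.

(** This is the action of [T] on the space of [N]-maps into [V]; its fixed points are the
    [T]-maps. *)
Lemma sub_hom_twist d (V : mx_representation F G d) f t :
  sub_hom V f -> t \in T -> sub_hom V (rT t^-1%g *m f *m V t).
Proof.
move=> homf Tt h Nh; have Th := subsetP sNT h Nh; have Gt := subsetP sTG t Tt.
rewrite -rT_N // -!mulmxA mulmxA -repr_mxM ?groupV //.
have ->: (h * t^-1 = t^-1 * (h ^ t^-1))%g by rewrite conjgE invgK !mulgA mulVg mul1g.
have Nht: (h ^ t^-1)%g \in N by rewrite memJ_norm ?groupV ?nNG.
rewrite (repr_mxM rT (groupVr Tt) (subsetP sNT _ Nht)) -mulmxA (rT_N Nht).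
congr (_ *m _).
by rewrite (hom_conj nsNG homf) // mulmxA.
Qed.

Lemma sub_hom_form d (V : mx_representation F G d) (C : 'M_d) f1 f2 :
    invariant_form V C -> sub_hom V f1 -> sub_hom V f2 ->
  exists a, f1 *m C *m f2^T = a *: B.
Proof.
move=> iC hom1 hom2; apply: (invariant_form_scale abs_r uB iB) => h Nh.
rewrite !mulmxA hom1 // -[_ *m f2^T *m _]mulmxA -trmx_mul hom2 // trmx_mul.
have iCQ (Q : 'M_(d, n)): V h *m (C *m ((V h)^T *m Q)) = C *m Q.
  by rewrite !mulmxA iC ?(subsetP sNG).
by rewrite -!mulmxA iCQ.
Qed.

Lemma sub_hom_form_twist d (V : mx_representation F G d) (C : 'M_d) f t :
    invariant_form V C -> t \in T ->
  rT t^-1%g *m f *m V t *m C *m (rT t^-1%g *m f *m V t)^T =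
  rT t^-1%g *m (f *m C *m f^T) *m (rT t^-1%g)^T.
Proof.
move=> iC Tt; rewrite !trmx_mul.
have iCQ (Q : 'M_(d, n)): V t *m (C *m ((V t)^T *m Q)) = C *m Q.
  by rewrite !mulmxA iC ?(subsetP sTG).
by rewrite -!mulmxA iCQ.
Qed.

(** A nonzero pairing would identify [r] with the dual of its [x]-conjugate; as [r] is self-dual,
    [x] would fix [phi]. *)
Lemma conj_orthogonal d (V : mx_representation F G d) (C : 'M_d) f1 f2 x :
    invariant_form V C -> sub_hom V f1 -> sub_hom V f2 -> x \in G -> x \notin T ->
  f1 *m C *m (f2 *m V x)^T = 0.
Proof.
move=> iC hom1 hom2 Gx notTx; apply/eqP/negPn/negP=> nzH; case/negP: notTx.
pose rx := conj_repr r (nNG Gx).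
have abs_rx: mx_absolutely_irreducible rx.
  by apply: (irr_abs_irr hF sNG); apply: conj_repr_irr.
have sim: mx_rsim r (dual_repr rx).
  apply: irr_hom_rsim (irr_r) (mx_abs_irrW (dual_repr_abs_irr abs_rx)) _ nzH => h Nh.
  have Gh := subsetP sNG h Nh; have NhV := groupVr Nh.
  rewrite !mulmxA hom1 // -[f1 *m V h *m C]mulmxA ((invariant_formP V C).1 iC) //= !mulmxA.
  rewrite -!mulmxA -!trmx_mul; congr (_ *m (_ *m _^T)).
  by rewrite (hom_conj nsNG hom2).
have dual_r: mx_rsim (dual_repr r) r.
  apply: mx_rsim_sym; exists B; rewrite ?row_free_unit //.
  exact/invariant_formP.
apply: (conj_rsim_stab hsys hK nsNG phi_r Gx (nNt := nNG Gx)).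
exact: mx_rsim_sym (mx_rsim_trans (mx_rsim_dual sim) dual_r).
Qed.

(* An isotropic copy of [r] in [V] has only isotropic conjugates, so the Gram *)
(* matrix of the copies of [r] in a Clifford decomposition built from it is   *)
(* alternating; being nondegenerate it has even size.                         *)
Lemma isotropic_even d (V : mx_representation F G d) (C : 'M_d) f (X : {set gT}) :
    mx_irreducible V -> C \in unitmx -> invariant_form V C ->
    sub_hom V f -> f != 0 -> f *m C *m f^T = 0 ->
    X \subset G -> (\sum_(x in X) <<f *m V x>> :=: 1%:M)%MS ->
    {in X, forall x,
      (<<f *m V x>> :&: \sum_(y in X | y != x) <<f *m V y>> = 0)%MS} ->
  ~~ odd #|X :&: T|.
Proof.
move=> irrV uC iC homf nzf iso sXG sumX dxX; apply/negP=> oddY.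
have symC: C^T = C.
  exact: invariant_form_sym pcharF (irr_abs_irr hF (subxx G) irrV) uC iC.
pose y (i : 'I_#|X :&: T|) : gT := enum_val i.
have yX i: y i \in X by have := enum_valP i; rewrite inE => /andP[].
have yT i: y i \in T by have := enum_valP i; rewrite inE => /andP[].
pose fy i := rT (y i)^-1%g *m f *m V (y i).
have homfy i: sub_hom V (fy i) by apply: sub_hom_twist.
have /fin_all_exists[gam gamE] ij :=
  sub_hom_form iC (homfy ij.1) (homfy ij.2).
pose M := \matrix_(i, j) gam (i, j).
have ME i j: fy i *m C *m (fy j)^T = M i j *: B by rewrite mxE -gamE.
have injB a b: a *: B = b *: B -> a = b.
  by move/eqP; rewrite -subr_eq0 -scalerBl scaler_eq0 (negPf nzB) orbF subr_eq0 => /eqP.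
have detM: \det M = 0.
  apply: (det_alternating_odd pcharF oddY) => [|i].
    apply/matrixP=> i j; rewrite mxE; apply: injB.
    have tr: (fy i *m C *m (fy j)^T)^T = fy j *m C *m (fy i)^T.
      by rewrite trmx_mul trmxK (trmx_mul (fy i) C) symC mulmxA.
    by rewrite -ME -tr ME linearZ /= symB.
  apply: injB; rewrite -ME sub_hom_form_twist // iso mulmx0 mul0mx scale0r //.
have [v nzv vM]: exists2 v : 'rV_#|X :&: T|, v != 0 & v *m M = 0 by apply/det0P/eqP.
(* The kernel vector [v] makes [f'] orthogonal to the translates by [T]; the other translates are
   orthogonal to it anyway. So [f'] is 0 by nondegeneracy of [C], against the directness of the
   decomposition. *)
pose f' := \sum_i v 0 i *: fy i.
have homf': sub_hom V f'.
  move=> h Nh; rewrite mulmx_suml mulmx_sumr; apply: eq_bigr => i _.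
  by rewrite -scalemxAr -scalemxAl homfy.
have f'fy j: f' *m C *m (fy j)^T = 0.
  rewrite !mulmx_suml; transitivity ((\sum_i v 0 i * M i j) *: B); last first.
    by have := congr1 (fun A : 'rV_ _ => A 0 j) vM; rewrite !mxE => ->; rewrite scale0r.
  by rewrite scaler_suml; apply: eq_bigr => i _; rewrite -!scalemxAl ME scalerA.
have f'0: f' = 0.
  have: f' *m C = 0; last by move/(canRL (mulmxK uC)); rewrite mul0mx.
  apply: trmx_inj; rewrite trmx0 -[LHS]mul1mx; apply/sub_kermxP; rewrite -sumX.
  apply/sumsmx_subP=> x Xx; rewrite genmxE; apply/sub_kermxP/trmx_inj.
  have Gx := subsetP sXG x Xx; rewrite trmx0 trmx_mul trmxK.
  have [Tx | notTx] := boolP (x \in T); last exact: conj_orthogonal.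
  have Yx: x \in X :&: T by rewrite inE Xx.
  have defx: y (enum_rank_in Yx x) = x by apply: enum_rankK_in.
  have ->: f *m V x = rT x *m fy (enum_rank_in Yx x).
    by rewrite /fy defx !mulmxA -repr_mxM ?groupV // mulgV repr_mx1 mul1mx.
  by rewrite trmx_mul mulmxA f'fy mul0mx.
have [i nzvi]: exists i, v 0 i != 0.
  apply/existsP; apply: contraR nzv => /existsPn v0; apply/eqP/rowP=> i.
  by rewrite mxE; apply/eqP/negPn.
have le_fy j: (fy j <= <<f *m V (y j)>>)%MS by rewrite genmxE /fy -mulmxA submxMl.
have: (fy i <= <<f *m V (y i)>> :&: \sum_(x in X | x != y i) <<f *m V x>>)%MS.
  rewrite sub_capmx le_fy /=.
  have: v 0 i *: fy i = - \sum_(j | j != i) v 0 j *: fy j.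
    by apply/eqP; rewrite -addr_eq0; rewrite /f' (bigD1 i) //= in f'0; apply/eqP.
  move/(congr1 (fun A => (v 0 i)^-1 *: A)); rewrite scalerA mulVf // scale1r => ->.
  apply/scalemx_sub; rewrite eqmx_opp; apply: summx_sub => j j'i; apply: scalemx_sub.
  apply: submx_trans (le_fy j) _; apply: (sumsmx_sup (y j)) => //.
  by rewrite yX /=; apply: contraNneq j'i => /enum_val_inj->.
rewrite dxX // submx0 => /eqP fy0; case/eqP: nzf.
have Gy := subsetP sTG _ (yT i).
rewrite -[f]mul1mx -(repr_mx1 rT) -(mulgV (y i)) repr_mxM ?groupV // -mulmxA.
rewrite -[_ *m f](repr_mxK V Gy); move: fy0; rewrite /fy => ->.
by rewrite mul0mx mulmx0.
Qed.

(** Only the parity of [m] is used: it is shared by every Clifford decomposition of [V], so by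
    [isotropic_even] no nonzero [N]-map is isotropic. *)
Lemma odd_multiplicity_stab_hom d (V : mx_representation F G d) theta m :
    mx_irreducible V -> brauer_of V theta -> self_dual theta ->
    multiplicity 2 red N phi (res_char N theta) m -> odd m ->
  exists2 f, stab_hom V f & f != 0.
Proof.
move=> irrV theta_V sd_theta mult odd_m.
have absV := irr_abs_irr hF (subxx G) irrV.
have [C uC iC] := self_dual_invariant_form absV (self_dual_mxtrace hsys theta_V sd_theta).
have symC: C^T = C by apply: invariant_form_sym pcharF absV uC iC.
have irr_phi: irr_brauer_char 2 red N phi by exists n, r.
have count_odd n1 (r1 : mx_representation F N n1) f1 phi1 (X : {set gT}) :
    mx_irreducible r1 -> brauer_of r1 phi1 ->
    {in N, forall h, r1 h *m f1 = f1 *m V h} ->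
    X \subset G -> (\sum_(x in X) <<f1 *m V x>> :=: 1%:M)%MS -> d = (#|X| * n1)%N ->
  odd (count_mem phi [seq conj_char phi1 x | x <- enum X]).
  move=> irr1 phi1_r1 hom1 sXG sumX dimX; have [s [irr_s sum_s count_s]] := mult.
  have := count_irr_brauer hsys hK hF (s1 := s)
    (s2 := [seq conj_char phi1 x | x <- enum X]) sNG irr_phi.
  rewrite count_s => count_eq; have := odd_m; rewrite -[odd _]negbK -dvdn2.
  rewrite (dvdn_pcharf pcharF) count_eq.
  - by rewrite -(dvdn_pcharf pcharF) dvdn2 negbK.
  - move=> chi; rewrite mem_cat => /orP[/irr_s // | /mapP[x]].
    rewrite mem_enum => /(subsetP sXG) Gx ->.
    by apply: (conj_irr_brauer nsNG Gx); exists n1, r1.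
  by rewrite -sum_s (Clifford_restriction hsys hK nsNG hom1 phi1_r1 theta_V sXG sumX dimX).
(* Decompose [V] into conjugates of any simple [N]-submodule. The odd count shows that [phi] is
   afforded by one of them, and translating the inclusion of the submodule gives [f]. *)
have [f homf nzf]: exists2 f, sub_hom V f & f != 0.
  apply: NNPP => no_f; have nz1: (1%:M : 'M[F]_d) != 0 by case: irrV.
  suffices: false by [].
  apply: (mxsimple_exists (mxmodule1 (subg_repr V sNG)) nz1 (b := false)).
  case=> M simM _; have modM := mxsimple_module simM.
  pose r1 := submod_repr modM; pose f1 : 'M_(\rank M, d) := val_submod 1%:M.
  have irr1: mx_irreducible r1 by apply/submod_mx_irr.
  have hom1: {in N, forall h, r1 h *m f1 = f1 *m V h}.
    move=> h Nh; rewrite /f1 -val_submodE.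
    have := val_submodJ modM (1%:M : 'M_(\rank M)) Nh; rewrite mul1mx => -> //.
  have nzf1: f1 != 0 by rewrite val_submod_eq0 -mxrank_eq0 mxrank1 mxrank_eq0; case: simM.
  have [phi1 phi1_r1] := brauer_of_exists hsys hK r1 sNG.
  have [X [sXG sumX dimX _]] := Clifford_hom_basis nsNG irrV irr1 hom1 nzf1.
  have := count_odd _ _ _ _ _ irr1 phi1_r1 hom1 sXG sumX dimX.
  have [/mapP[x] | /count_memPn-> //] := boolP (phi \in [seq conj_char phi1 x | x <- enum X]).
  rewrite mem_enum => /(subsetP sXG) Gx def_phi _; case: no_f.
  have [|P eq_n freeP homP] := brauer_of_rsim hsys hF sNG irr_r
      (conj_repr_irr (nNG Gx) irr1) phi_r.
    by rewrite def_phi; apply: brauer_of_conj.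
  exists (P *m (f1 *m V x)).
    move=> h Nh; rewrite [LHS]mulmxA homP // -[LHS]mulmxA -[RHS]mulmxA.
    by rewrite -(hom_conj nsNG hom1).
  rewrite mulmxA -mxrank_eq0 mxrankMfree ?repr_mx_free //.
  have uf1: row_free f1 by apply: (irr_hom_free (rG := V) irr1 hom1 nzf1).
  by rewrite mxrankMfree // (eqP freeP) -lt0n.
have aniso g: sub_hom V g -> g *m C *m g^T = 0 -> g = 0.
  move=> homg isog; apply/eqP/negPn/negP=> nzg.
  have [X [sXG sumX dimX dxX]] := Clifford_hom_basis nsNG irrV irr_r homg nzg.
  have := count_odd _ _ _ _ _ irr_r phi_r homg sXG sumX dimX.
  by rewrite (count_conj phi sXG); apply/negP/(isotropic_even irrV uC iC homg nzg isog).
(* In characteristic 2, [ft - f] is isotropic: the four terms of its norm     *)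
(* cancel in pairs.                                                          *)
exists f => // t Tt; pose ft := rT t^-1%g *m f *m V t.
have homft: sub_hom V ft by apply: sub_hom_twist.
have [a fCf] := sub_hom_form iC homf homf; have [b ftCf] := sub_hom_form iC homft homf.
have ftCft: ft *m C *m ft^T = a *: B.
  by rewrite sub_hom_form_twist // fCf -scalemxAr -scalemxAl iBT ?groupV.
have fCft: f *m C *m ft^T = b *: B.
  have <-: (ft *m C *m f^T)^T = f *m C *m ft^T.
    by rewrite trmx_mul trmxK (trmx_mul ft C) symC mulmxA.
  by rewrite ftCf linearZ /= symB.
have /eqP: ft - f = 0.
  apply: aniso => [h Nh|]; first by rewrite mulmxBl mulmxBr homf // homft.
  have addMM (A : 'M[F]_n) : A + A = 0.
    by apply/matrixP=> i j; rewrite !mxE addrr_pchar2.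
  rewrite linearB /= mulmxBl !mulmxBr !mulmxBl ftCft fCf ftCf fCft.
  by rewrite opprB addrACA -opprD addMM addMM subrr.
rewrite subr_eq0 => /eqP eq_f; rewrite -{1}eq_f /ft !mulmxA -repr_mxM ?groupV //.
by rewrite mulgV repr_mx1 mul1mx.
Qed.

(* The row vectors [m rT(t)^-1 l] indexed by [t], for a fixed linear form [l], *)
(* embed [rT] in the restriction of the regular representation of [G].        *)
Lemma stab_hom_exists : exists d (V : mx_representation F G d),
  mx_irreducible V /\ exists2 f, stab_hom V f & f != 0.
Proof.
pose i0 := Ordinal n_gt0; pose l : 'cV[F]_n := delta_mx i0 0.
pose e g : 'rV[F]_#|G| := delta_mx 0 (gring_index G g).
have eM g x : g \in G -> e g *m regular_repr F G x = e (g * x)%g.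
  by move=> Gg; rewrite -rowE rowK gring_indexK.
pose A := \sum_(t in T) rT t^-1%g *m l *m e t.
have homA t : t \in T -> rT t *m A = A *m regular_repr F G t.
  move=> Tt; rewrite mulmx_sumr mulmx_suml (reindex_inj (mulIg t)) /=.
  apply: eq_big => [u | u]; first by rewrite groupMr.
  rewrite groupMr // => Tu; rewrite -[RHS]mulmxA eM ?(subsetP sTG) // !mulmxA.
  by rewrite invMg repr_mxM ?groupV // mulmxA -repr_mxM ?groupV // mulgV repr_mx1 mul1mx.
have nzA : A != 0.
  apply/eqP=> A0; have := congr1 (fun M : 'M_(n, #|G|) => M i0 (gring_index G 1%g)) A0.
  rewrite summxE (bigD1 1%g) //= big1 => [|t /andP[Tt t'1]].
    rewrite invg1 repr_mx1 mul1mx addr0 !mxE big_ord1 !mxE !eqxx mulr1.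
    by move/eqP; rewrite oner_eq0.
  rewrite mxE big_ord1 [e t _ _]mxE eqxx /=.
  case: eqP => [/(congr1 enum_val)|_]; last by rewrite mulr0.
  by rewrite !gring_indexK ?(subsetP sTG) // => t1; rewrite -t1 eqxx in t'1.
have [d [V [f [irrV nzf homf]]]] := irreducible_quotient_hom (regular_repr F G) nzA.
exists d, V; split=> //; exists f => // t Tt.
by apply: homf; [apply: (subsetP sTG) | apply: homA].
Qed.

End OddMultiplicity.

Theorem theorem2 (gT : finGroupType) (G N : {group gT})
    (R : idomainType) (F : fieldType) (red : {rmorphism R -> F})
    (hsys : modular_system 2 red)
    (hK : splits_subgroups {fraction R} G) (hF : splits_subgroups F G)
    (hN : N <| G)
    (phi : {ffun gT -> R}) (hphi : irr_brauer_char 2 red N phi)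
    (hdual : self_dual phi) :
  let extension (psi : {ffun gT -> R}) :=
    brauer_char 2 red (char_stab_group G phi) psi /\ res_char N psi = phi in
  let odd_over (theta : {ffun gT -> R}) :=
    [/\ irr_brauer_char 2 red G theta, self_dual theta
      & exists2 m : nat, multiplicity 2 red N phi (res_char N theta) m & odd m] in
  [/\ (exists psi : {ffun gT -> R}, extension psi) /\
      (exists! psi : {ffun gT -> R}, extension psi /\ self_dual psi),
      exists! theta : {ffun gT -> R}, odd_over theta
    & forall theta : {ffun gT -> R}, odd_over theta ->
        multiplicity 2 red N phi (res_char N theta) 1].
Proof.
move=> extension odd_over; have [n [r [irr_r phi_r]]] := hphi.
have sNG := normal_sub hN; have sTG := char_stab_sub G phi.
have abs_r := irr_abs_irr hF sNG irr_r.
have [B uB iB] := self_dual_invariant_form abs_r (self_dual_mxtrace hsys phi_r hdual).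
have [rT [rT_N rT_isom]] := self_dual_extension_exists hsys hK hF hN irr_r phi_r uB iB.
have iBT: invariant_form rT B by move=> t /rT_isom[].
have [psi psi_rT] := brauer_of_exists hsys hK rT sTG.
have sNT := sub_char_stab hsys hK hN phi_r.
have ext_psi: extension psi.
  split; first by exists n, rT.
  apply: (brauer_of_uniq hsys hK sNG (brauer_of_res sNT psi_rT)).
  by apply: brauer_of_char_poly phi_r => h Nh /=; rewrite rT_N.
have sd_psi: self_dual psi := brauer_of_self_dual hsys hK sTG psi_rT uB iBT.
(* Uniqueness of [theta] and part (iii) depend on [theta] only through this nonzero [T]-map. *)
have odd_hom theta : odd_over theta -> exists d (V : mx_representation F G d) f,
    [/\ mx_irreducible V, brauer_char_of 2 red V theta, stab_hom rT V f & f != 0].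
  case=> [[d [V [irrV theta_V]]] sd_theta [m mult odd_m]].
  have [f homf nzf] := odd_multiplicity_stab_hom hsys hK hF hN irr_r phi_r uB
    rT_N iBT irrV theta_V sd_theta mult odd_m.
  by exists d, V, f.
have mult1 := stab_hom_multiplicity hsys hK hF hN irr_r phi_r rT_N.
split.
- split; first by exists psi.
  exists psi; split=> // psi' [[brauer_psi' res_psi'] sd_psi'].
  exact: (self_dual_extension_uniq hsys hK hF hN irr_r phi_r uB iB
    rT_isom psi_rT brauer_psi' res_psi' sd_psi').
- have [d [V [irrV [f homf nzf]]]] := stab_hom_exists hF hN irr_r rT.
  have [theta theta_V] := brauer_of_exists hsys hK V (subxx G).
  exists theta; split.
    split; first by exists d, V.
      exact: (stab_hom_self_dual hsys hK hF hN irr_r phi_r uB rT_N iBT irrV homf).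
    by exists 1%N => //; apply: mult1 homf nzf theta_V.
  move=> theta' /odd_hom[d' [V' [f' [irrV' theta'_V' homf' nzf']]]].
  apply: (brauer_of_uniq hsys hK (subxx G) theta_V).
  apply: brauer_of_char_poly theta'_V'; apply: char_poly_rsim.
  exact: (stab_hom_rsim hsys hK hF hN irr_r phi_r rT_N irrV' irrV homf' homf).
by move=> theta /odd_hom[d [V [f [irrV theta_V homf nzf]]]]; apply: mult1 homf nzf theta_V.
Qed.
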